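(* Let $\mathcal{Q}\subset\mathbb{R}^n$ be compact and let $(\mathcal{E},\mathcal{D})$ be a compression code for $\mathcal{Q}$ operating at rate $r$ and distortion $\delta$, with codebook $\mathcal{C}$. Let $A\in\mathbb{R}^{d\times n}$ have i.i.d. $\mathcal{N}(0,1)$ entries and let ${\bf z}\sim\mathcal{N}(0,\sigma^2I_d)$ be independent of $A$. For ${\bf x}_o\in\mathcal{Q}$ let $\hat{{\bf x}}_o$ be any element of $\arg\min_{{\bf c}\in\mathcal{C}}\|A{\bf x}_o+{\bf z}-A{\bf c}\|_2^2$. Then for $\tau\in(0,1)$ and $t,\gamma>0$, the probability that there exists ${\bf x}_o\in\mathcal{Q}$ with \[ \|{\bf x}_o-\hat{{\bf x}}_o\|_2\ge\frac{2(\sqrt n+(t+1)\sqrt d)\delta+2\gamma\sigma}{\sqrt{(1-\tau)d}}+\delta \] is at most \[ {\rm e}^{-dt^2/2}+2^{2r}\big({\rm e}^{-\gamma^2/2}+{\rm e}^{\frac d2(\tau+\log(1-\tau))}\big). \]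
   Context: A compression code $(\mathcal{E},\mathcal{D})$ for $\mathcal{Q}$ at rate $r$ consists of an encoder $\mathcal{E}:\mathcal{Q}\to\{1,2,\dots,2^r\}$ and a decoder $\mathcal{D}:\{1,\dots,2^r\}\to\mathbb{R}^n$; its codebook is $\mathcal{C}=\{\mathcal{D}(\mathcal{E}({\bf x})):{\bf x}\in\mathcal{Q}\}$, and its distortion is $\delta=\sup_{{\bf x}\in\mathcal{Q}}\|{\bf x}-\mathcal{D}(\mathcal{E}({\bf x}))\|_2$. $\log$ is the natural logarithm. The probability is over $A$ and ${\bf z}$. *)

(* Defs.v *)
From HB Require Import structures.
From mathcomp Require Import all_boot all_order all_algebra.
From mathcomp Require Import all_classical all_reals all_analysis.
Set Implicit Arguments. Unset Strict Implicit. Unset Printing Implicit Defensive.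
Import Order.TTheory GRing.Theory Num.Theory.
Import numFieldNormedType.Exports.
Local Open Scope classical_set_scope.
Local Open Scope ring_scope.

Definition norm2 {R : realType} {k : nat} (v : 'cV[R]_k) : R :=
  Num.sqrt (\sum_(i < k) v i 0 ^+ 2).

(* Codebook of the compression code (enc, dec) at rate r for Q:
   { dec (enc x) : x in Q }.  Messages {1,...,2^r} are represented by 'I_(2^r). *)
Definition codebook {R : realType} {n r : nat} (Q : set 'cV[R]_n)
  (enc : 'cV[R]_n -> 'I_(2 ^ r)) (dec : 'I_(2 ^ r) -> 'cV[R]_n) : set 'cV[R]_n :=
  [set dec (enc x) | x in Q].

Definition distortion {R : realType} {n r : nat} (Q : set 'cV[R]_n)
  (enc : 'cV[R]_n -> 'I_(2 ^ r)) (dec : 'I_(2 ^ r) -> 'cV[R]_n) : R :=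
  sup [set norm2 (x - dec (enc x)) | x in Q].

(* Mutual independence of a finite family of real random variables:
   the joint law of (X_i)_i is the product rule on every family of Borel sets
   (taking B_i = setT recovers the product rule for every finite subfamily). *)
Definition mutually_independent {d : measure_display} {T : measurableType d}
  {R : realType} (P : probability T R) {I : finType} (X : I -> T -> R) : Prop :=
  forall B : I -> set R, (forall i, measurable (B i)) ->
    P (\big[setI/setT]_(i : I) (X i @^-1` B i)) =
    (\prod_(i : I) P (X i @^-1` B i))%E.

Definition argmin_code {R : realType} {n m : nat} (C : set 'cV[R]_n)
  (A : 'M[R]_(m, n)) (y : 'cV[R]_m) : set 'cV[R]_n :=
  [set c | C c /\ forall c', C c' -> norm2 (y - A *m c) ^+ 2 <= norm2 (y - A *m c') ^+ 2].

(* Main.v *)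
(** Let [v = c - c'] be the difference of the codeword [c] of [x] and the
    decoded codeword [c'], and [y = A v].  Minimality of [c'] gives
    [|y|^2 <= 2 |A^T y| delta + 2 <y, -z>], so a large error forces, with
    [K = sqrt n + (t + 1) sqrt d], one of
    - [|y|^2 <= (1 - tau) d |v|^2];
    - [|y|^4 K^2 <= (1 - tau) d |A^T y|^2 |v|^2];
    - [<-z, y> >= gamma sigma |y|].
    Each is an event about one fixed [v], bounded by a Chernoff estimate, so that
    no bound on the operator norm of [A] is needed.  For the second one, rotate
    coordinates so that [v] is the first basis vector (if [|v| = 1]): then
    [|A^T y|^2 / |y|^2] is [|y|^2] plus the squared norm of the projections on [y]
    of the other columns, which are independent of [y].  The first two events are
    even in [v], hence only [N (N - 1) / 2] pairs of codewords count for them, which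
    absorbs the factor 2.  The summand [exp (- d t^2 / 2)] is only needed when [d = 0]. *)

Require Import Defs.
From HB Require Import structures.
From mathcomp Require Import all_boot all_order all_algebra.
From mathcomp Require Import all_classical all_reals all_analysis.
From mathcomp Require Import measurable_realfun.
From mathcomp Require Import ring lra.
Import Order.TTheory GRing.Theory Num.Theory.
Import numFieldNormedType.Exports.
Set Implicit Arguments.
Unset Strict Implicit.
Unset Printing Implicit Defensive.
Local Open Scope classical_set_scope.
Local Open Scope ring_scope.

(** * Integrals against the normal law *)

Section normal_integrals.
Context {R : realType}.
Local Notation mu := (@lebesgue_measure R).
Implicit Types (m s a c : R).
Local Open Scope ereal_scope.

Import HBNNSimple.

(** Independence is given only as a product rule on boxes, whereas the tail bounds argue for [A], or
    one column of it, held fixed. The rule is therefore extended to the sigma-algebras generated by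
    disjoint blocks of entries, and [decoupling] then turns an integral over the diagonal into an
    iterated one, which plays the role of conditioning. Rotational invariance is built from
    rotations of two entries of a row, so that on the analytic side translation invariance of the
    Lebesgue measure and Tonelli suffice.

    The size of [K] is explained by typical values: for [|v| = 1], [|A^T y|^2 / |y|^2] is of order
    [n + d]. As soon as [K^2 >= n + d], the Chernoff parameter that is optimal for the first event
    gives the second one the same rate. For fixed [A], the third event is a one-sided deviation of a
    centred normal variable of standard deviation [sigma], whatever the direction of [y]. *)

Let integral_normal_nnsfun m s (f : {nnsfun _ >-> R}) :
  \int[normal_prob m s]_x (f x)%:E = \int[mu]_x ((f x)%:E * (normal_pdf m s x)%:E).
Proof.
have mp : measurable_fun setT (fun x : R => (normal_pdf m s x)%:E : \bar R).
  by apply/measurable_EFinP; exact: measurable_normal_pdf.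
have p0 x : 0 <= (normal_pdf m s x)%:E by rewrite lee_fin normal_pdf_ge0.
under [LHS]eq_integral do rewrite fimfunE -fsumEFin//.
rewrite [LHS]ge0_integral_fsum//; last 2 first.
  - by move=> r; exact/measurable_EFinP/measurableT_comp.
  - by move=> n x _; rewrite EFinM nnfun_muleindic_ge0.
under [RHS]eq_integral.
  move=> x xD; rewrite fimfunE -fsumEFin// muleC ge0_mule_fsumr; last first.
    by move=> r; rewrite EFinM nnfun_muleindic_ge0.
  over.
rewrite [RHS]ge0_integral_fsum//; last 2 first.
  - move=> r; apply: emeasurable_funM => //.
    by apply/measurable_EFinP/measurableT_comp.
  - by move=> n x _; rewrite EFinM mule_ge0// nnfun_muleindic_ge0.
apply: eq_fsbigr => r _.
transitivity (\int[mu]_x (r%:E * ((\1_(f @^-1` [set r]) x)%:E * (normal_pdf m s x)%:E))); last first.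
  by apply: eq_integral => x _; rewrite EFinM [RHS]muleC muleA.
have [r0|r0] := leP 0%R r; last first.
  have -> : f @^-1` [set r] = set0.
    apply/seteqP; split => x //= fxr; have : (0 <= f x)%R by [].
    by rewrite fxr leNgt r0.
  under eq_integral do rewrite indic0/= mulr0.
  rewrite integral0.
  by under eq_integral do rewrite indic0/= mul0e mule0; rewrite integral0.
rewrite [RHS]ge0_integralZl//; last 2 first.
  - by apply: emeasurable_funM => //; exact/measurable_EFinP.
  - by move=> x _; rewrite mule_ge0// lee_fin.
rewrite integralZl_indic_nnsfun//= integral_indic//= setIT /normal_prob.
congr (_ * _); rewrite integral_mkcond; apply: eq_integral => x _.
by rewrite patchE indicE; case: ifPn => ?; rewrite ?mul1e ?mul0e.
Qed.

(** On indicators this is the definition of [normal_prob] by its density; simple functions follow by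
    linearity and the general case by monotone convergence. *)
Lemma integral_normal_prob m s (f : _ -> \bar R) :
  measurable_fun setT f -> (forall x, 0 <= f x) ->
  \int[normal_prob m s]_x f x = \int[mu]_x (f x * (normal_pdf m s x)%:E).
Proof.
move=> mf f0.
have mp : measurable_fun setT (fun x : R => (normal_pdf m s x)%:E : \bar R).
  by apply/measurable_EFinP; exact: measurable_normal_pdf.
have p0 x : 0 <= (normal_pdf m s x)%:E by rewrite lee_fin normal_pdf_ge0.
pose f_ := nnsfun_approx measurableT mf.
have cf x : (f_ n x)%:E @[n --> \oo] --> f x by exact: cvg_nnsfun_approx.
transitivity (lim (\int[normal_prob m s]_x (f_ n x)%:E @[n --> \oo])).
  rewrite -monotone_convergence//=.
  - apply: eq_integral => ? /[!inE] xD; apply/esym/cvg_lim => //=.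
  - by move=> n; exact/measurable_EFinP/measurable_funTS.
  - by move=> n ? _; rewrite lee_fin.
  - by move=> ? _ ? ? mn; rewrite lee_fin; exact/lefP/nd_nnsfun_approx.
under eq_fun do rewrite integral_normal_nnsfun.
rewrite -monotone_convergence//=.
- apply: eq_integral => x _; apply/cvg_lim => //.
  rewrite muleC; under eq_fun do rewrite muleC.
  by apply: cvgeZl.
- by move=> n; apply: emeasurable_funM => //; exact/measurable_EFinP/measurable_funTS.
- by move=> n ? _; rewrite mule_ge0// lee_fin.
- move=> x _ ? ? mn; rewrite lee_wpmul2r// lee_fin.
  exact/lefP/nd_nnsfun_approx.
Qed.

(** The image of the Lebesgue measure under a translation gives half-open intervals their length,
    hence is the Lebesgue measure. *)
Lemma integral_lebesgue_shift a (f : measurableTypeR R -> \bar R) :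
  measurable_fun setT f -> (forall x, 0 <= f x) ->
  \int[mu]_x f (x + a)%R = \int[mu]_x f x.
Proof.
move=> mf f0.
have ma : measurable_fun setT (fun x : measurableTypeR R => (x + a)%R : measurableTypeR R).
  exact: (@measurable_funD _ _ R).
rewrite -[LHS](@ge0_integral_pushforward _ _ _ _ _ _ ma mu setT f)//.
apply: eq_measure_integral => /= A mA _.
symmetry.
apply: lebesgue_measure_unique => // X [[b c]] _ <-.
change (mu `]b, c] = mu ((fun x : R => (x + a)%R) @^-1` `]b, c])).
have -> : (fun x : R => (x + a)%R) @^-1` `]b, c] = [set` `](b - a)%R, (c - a)%R]].
  by apply/seteqP; split => x /=; rewrite !in_itv/= ltrBlDr lerBrDr.
rewrite !lebesgue_measure_itv/= !lte_fin ltrD2r; case: ifP => // _.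
by rewrite -!EFinD; congr EFin; ring.
Qed.

(** With [y] integrated last, the shear is a translation of [x] by the constant [a * y]. *)
Lemma integral_lebesgue_shear (a : R)
    (G : measurableTypeR R * measurableTypeR R -> \bar R) :
  measurable_fun setT G -> (forall x, 0 <= G x) ->
  \int[mu]_x \int[mu]_y G ((x + a * y)%R, y) = \int[mu]_x \int[mu]_y G (x, y).
Proof.
move=> mG G0.
transitivity (\int[mu]_y \int[mu]_x G ((x + a * y)%R, y)).
  apply: (fubini_tonelli (m1 := mu) (m2 := mu)
    (fun p : measurableTypeR R * measurableTypeR R => G ((p.1 + a * p.2)%R, p.2))) => //.
  apply: measurableT_comp => //; apply: measurable_fun_pair => //=.
  by apply: (@measurable_funD _ _ R) => //; apply: (@measurable_funM _ _ R).
transitivity (\int[mu]_y \int[mu]_x G (x, y)); last first.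
  exact/esym/(fubini_tonelli (m1 := mu) (m2 := mu) G mG G0).
apply: eq_integral => y _ /=.
rewrite (@integral_lebesgue_shift (a * y) (fun x => G (x, y)))//.
exact: measurableT_comp.
Qed.

Lemma integral_lebesgue_rotation (c s : R)
    (G : measurableTypeR R * measurableTypeR R -> \bar R) :
  (c ^+ 2 + s ^+ 2 = 1)%R -> s != 0%R ->
  measurable_fun setT G -> (forall x, 0 <= G x) ->
  \int[mu]_x \int[mu]_y G ((c * x + s * y)%R, (c * y - s * x)%R) =
  \int[mu]_x \int[mu]_y G (x, y).
Proof.
move=> cs s0 mG G0.
(* For an angle with cosine [c] and sine [s], this is the tangent of half the angle, the slope of
   the two outer shears; the middle one has slope [- s]. *)
pose a : R := ((1 - c) / s)%R.
have aE : (a * s = 1 - c)%R by rewrite /a divfK.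
(* A rotation is the product of three shears. *)
pose G2 p := G ((p.1 + a * p.2)%R, p.2).
pose G1 p := G2 (p.1, (p.2 - s * p.1)%R).
have mG2 : measurable_fun setT G2.
  apply: measurableT_comp => //; apply: measurable_fun_pair => //=.
  by apply: (@measurable_funD _ _ R) => //; apply: (@measurable_funM _ _ R).
have mG1 : measurable_fun setT G1.
  apply: measurableT_comp => //; apply: measurable_fun_pair => //=.
  by apply: (@measurable_funB _ _ R) => //; apply: (@measurable_funM _ _ R).
rewrite -(integral_lebesgue_shear a mG G0).
transitivity (\int[mu]_x \int[mu]_y G1 (x, y)).
  rewrite -(integral_lebesgue_shear a mG1); last by move=> x; rewrite /G1 /G2.
  rewrite /G1 /G2/=.
  apply: eq_integral => x _; apply: eq_integral => y _ /=.
  have sE : (s * a * a = 2 * a - s)%R.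
    apply: (mulIf s0); have -> : (s * a * a * s = (a * s) * (a * s))%R by ring.
    rewrite aE; have -> : ((2 * a - s) * s = 2 * (a * s) - s ^+ 2)%R by ring.
    rewrite aE; have -> : (s ^+ 2 = 1 - c ^+ 2)%R by rewrite -cs; ring.
    by ring.
  congr (G (_, _)).
    have -> : (x + a * y + a * (y - s * (x + a * y)) =
      (1 - a * s) * x + (2 * a - s * a * a) * y)%R by ring.
    by rewrite aE sE; ring.
  have -> : (y - s * (x + a * y) = (1 - a * s) * y - s * x)%R by ring.
  by rewrite aE; ring.
apply: eq_integral => x _; rewrite /G1 /=.
rewrite -[LHS](@integral_lebesgue_shift (s * x) (fun y => G2 (x, (y - s * x)%R)))//.
- by apply: eq_integral => y _; rewrite addrK.
- apply: measurableT_comp => //; apply: measurable_fun_pair => //=.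
  exact: (@measurable_funB _ _ R).
- by move=> y; rewrite /G2.
Qed.

(** The product of two standard normal densities depends on [x ^+ 2 + y ^+ 2] only, so it can be
    carried through the rotation and the planar Lebesgue invariance applies. *)
Lemma integral_normal_rotation (c s : R)
    (f : measurableTypeR R * measurableTypeR R -> \bar R) :
  (c ^+ 2 + s ^+ 2 = 1)%R -> s != 0%R ->
  measurable_fun setT f -> (forall x, 0 <= f x) ->
  \int[normal_prob 0 1]_x \int[normal_prob 0 1]_y f ((c * x + s * y)%R, (c * y - s * x)%R) =
  \int[normal_prob 0 1]_x \int[normal_prob 0 1]_y f (x, y).
Proof.
move=> cs s0 mf f0.
have p0 x : 0 <= (normal_pdf 0 1 x)%:E :> \bar R by rewrite lee_fin normal_pdf_ge0.
have mp : measurable_fun setT (fun x : measurableTypeR R => (normal_pdf 0 1 x)%:E : \bar R).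
  by apply/measurable_EFinP; exact: measurable_normal_pdf.
have E (g : measurableTypeR R * measurableTypeR R -> \bar R) :
    measurable_fun setT g -> (forall x, 0 <= g x) ->
  \int[normal_prob 0 1]_x \int[normal_prob 0 1]_y g (x, y) =
  \int[mu]_x \int[mu]_y
    (g (x, y) * ((normal_pdf 0 1 x)%:E * (normal_pdf 0 1 y)%:E)).
  move=> mg g0; rewrite integral_normal_prob; last 2 first.
  - exact: (measurable_fun_fubini_tonelli_F (m2 := normal_prob 0 1) g mg g0).
  - by move=> x; apply: integral_ge0.
  apply: eq_integral => x _.
  have mgx : measurable_fun setT (fun y => g (x, y)) by exact: measurableT_comp.
  rewrite integral_normal_prob// -ge0_integralZr//; last 2 first.
  - by apply: emeasurable_funM.
  - by move=> y _; rewrite mule_ge0.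
  by apply: eq_integral => y _; rewrite -muleA; congr (_ * _); rewrite muleC.
pose h p := f ((c * p.1 + s * p.2)%R, (c * p.2 - s * p.1)%R).
have mh : measurable_fun setT h.
  apply: measurableT_comp => //; apply: measurable_fun_pair => //=.
    by apply: (@measurable_funD _ _ R) => //; apply: (@measurable_funM _ _ R).
  by apply: (@measurable_funB _ _ R) => //; apply: (@measurable_funM _ _ R).
have h0 p : 0 <= h p by exact: f0.
transitivity (\int[mu]_x \int[mu]_y
    (h (x, y) * ((normal_pdf 0 1 x)%:E * (normal_pdf 0 1 y)%:E))).
  exact: (E h mh h0).
transitivity (\int[mu]_x \int[mu]_y
    (f (x, y) * ((normal_pdf 0 1 x)%:E * (normal_pdf 0 1 y)%:E))); last first.
  exact/esym/(E f mf f0).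
pose k p := f p * ((normal_pdf 0 1 p.1)%:E * (normal_pdf 0 1 p.2)%:E).
have mk : measurable_fun setT k.
  apply: emeasurable_funM => //; apply: emeasurable_funM.
    exact: (measurableT_comp mp measurable_fst).
  exact: (measurableT_comp mp measurable_snd).
have k0 p : 0 <= k p by rewrite /k mule_ge0// mule_ge0.
transitivity (\int[mu]_x \int[mu]_y k ((c * x + s * y)%R, (c * y - s * x)%R)); last first.
  exact: integral_lebesgue_rotation cs s0 mk k0.
apply: eq_integral => x _; apply: eq_integral => y _; rewrite /h /k/=; congr (_ * _).
rewrite -!EFinM !normal_pdfE ?oner_eq0// /normal_fun !subr0 !expr1n.
congr EFin; rewrite mulrACA [RHS]mulrACA -!expRD; congr (_ * expR _)%R.
by rewrite -!mulrDl -!opprD; congr (- _ / _)%R; rewrite -[LHS]mul1r -cs; ring.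
Qed.

(** Completing the square: weighting the density by [expR (l * x)] moves its mean to
    [l * sigma ^+ 2], up to the constant on the right. *)
Lemma integral_normal_expR (sigma l : R) : sigma != 0%R ->
  \int[normal_prob 0 sigma]_x (expR (l * x))%:E =
  (expR (l ^+ 2 * sigma ^+ 2 / 2))%:E.
Proof.
move=> s0.
have ml : measurable_fun setT (fun x : measurableTypeR R => (expR (l * x))%:E).
  by apply/measurable_EFinP; apply: measurableT_comp.
rewrite integral_normal_prob//.
transitivity (\int[mu]_x ((expR (l ^+ 2 * sigma ^+ 2 / 2))%:E *
    (normal_pdf (l * sigma ^+ 2) sigma x)%:E)).
  apply: eq_integral => x _; rewrite -!EFinM !normal_pdfE//; congr EFin.
  rewrite mulrCA [RHS]mulrCA; congr (_ * _)%R; rewrite /normal_fun -!expRD.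
  by congr expR; field.
rewrite ge0_integralZl//.
- by rewrite integral_normal_pdf mule1.
- by apply/measurable_EFinP; exact: measurable_normal_pdf.
- by move=> x _; rewrite lee_fin normal_pdf_ge0.
Qed.

(** The weight turns the standard density into a multiple of the centred one with standard deviation
    [(Num.sqrt (1 - c))^-1]. *)
Lemma integral_normal_expR_sqr (c : R) : (c < 1)%R ->
  \int[normal_prob 0 1]_x (expR (c * x ^+ 2 / 2))%:E =
  (Num.sqrt (1 - c))^-1%:E.
Proof.
move=> c1.
have d0 : (0 < 1 - c)%R by rewrite subr_gt0.
pose t := Num.sqrt (1 - c); have t0 : (0 < t)%R by rewrite sqrtr_gt0.
have tE : (t ^+ 2 = 1 - c)%R by rewrite sqr_sqrtr// ltW.
have mc : measurable_fun setT (fun x : measurableTypeR R => (expR (c * x ^+ 2 / 2))%:E).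
  apply/measurable_EFinP; apply: measurableT_comp => //.
  by apply: (@measurable_funM _ _ R) => //; apply: (@measurable_funM _ _ R) => //.
rewrite integral_normal_prob//.
transitivity (\int[mu]_x (t^-1%:E * (normal_pdf 0 t^-1 x)%:E)).
  apply: eq_integral => x _; rewrite -!EFinM !normal_pdfE ?oner_eq0 ?invr_neq0 ?gt_eqF//.
  congr EFin; rewrite mulrCA [RHS]mulrA; congr (_ * _)%R.
    rewrite /normal_peak expr1n mul1r exprVn -mulrnAr sqrtrM; last by rewrite invr_ge0 sqr_ge0.
    rewrite invfM sqrtrV ?sqr_ge0// sqrtr_sqr gtr0_norm// invrK mulrA mulVf ?gt_eqF//.
    by rewrite mul1r.
  rewrite /normal_fun -expRD !subr0; congr expR; rewrite exprVn tE; field.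
  by rewrite gt_eqF.
rewrite ge0_integralZl//.
- by rewrite integral_normal_pdf mule1.
- by apply/measurable_EFinP; exact: measurable_normal_pdf.
- by move=> x _; rewrite lee_fin normal_pdf_ge0.
- by rewrite lee_fin invr_ge0 ltW.
Qed.

End normal_integrals.

(** * Decoupling of independent blocks *)

(* [<<s cylinders X J >>] is the sub-sigma-algebra of [T] generated by the [X i],
   [i] in [J]; it stands for the joint law of a block of variables, so that no
   measurable structure on families of reals is needed. *)
Definition cylinders {T : Type} {R : realType} {I : finType} (X : I -> T -> R)
    (J : pred I) : set (set T) :=
  [set \big[setI/setT]_i (X i @^-1` B i) | B in
    [set B : I -> set R | (forall i, measurable (B i)) /\
                          (forall i, ~~ J i -> B i = setT)]].

Section decoupling.
Context {dsp : measure_display} {T : measurableType dsp} {R : realType}.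
Variables (P : probability T R) (I : finType) (X : I -> T -> R).
Hypothesis mX : forall i, measurable_fun setT (X i).
Hypothesis indX : mutually_independent P X.
Implicit Types J : pred I.

Lemma cylindersI J : setI_closed (cylinders X J).
Proof.
move=> _ _ [B [mB BJ] <-] [C [mC CJ] <-].
exists (fun i => B i `&` C i); last by rewrite -big_split.
split=> [i|i Ji]; first exact: measurableI.
by rewrite BJ// CJ// setIT.
Qed.

Lemma cylindersT J : cylinders X J setT.
Proof.
exists (fun=> setT); first by [].
by rewrite big1// => i _; rewrite preimage_setT.
Qed.

Lemma cylinders_preimage J i B : J i -> measurable B ->
  cylinders X J (X i @^-1` B).
Proof.
move=> Ji mB; exists (fun j => if j == i then B else setT).
  split=> j; first by case: ifP.
  by case: ifP => // /eqP ->; rewrite Ji.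
rewrite (bigD1 i)//= eqxx big1 ?setIT// => j /negbTE ->.
by rewrite preimage_setT.
Qed.

Lemma cylinders_measurable J : cylinders X J `<=` measurable.
Proof.
move=> _ [B [mB _] <-]; apply: bigsetI_measurable => i _.
by rewrite -[X in measurable X]setTI; exact: mX.
Qed.

Lemma measurable_fun_cylinders J i : J i ->
  measurable_fun setT (X i : g_sigma_algebraType (cylinders X J) -> R).
Proof.
move=> Ji _ B mB; rewrite setTI; apply: sub_sigma_algebra.
exact: cylinders_preimage.
Qed.

Lemma measurable_id_cylinders J :
  measurable_fun setT (id : T -> g_sigma_algebraType (cylinders X J)).
Proof.
move=> _ B mB; rewrite setTI preimage_id.
exact: (smallest_sub (@sigma_algebra_measurable _ T) (@cylinders_measurable J)).
Qed.

Let mT J (A : set T) : <<s cylinders X J >> A -> measurable A.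
Proof.
exact: (smallest_sub (@sigma_algebra_measurable _ T) (@cylinders_measurable J)).
Qed.

(** The intersection of the two boxes is again a box, and at each index at least one of the two
    sides is [setT], so the product splits. *)
Lemma independent_cylinders J K A B : (forall i, ~~ (J i && K i)) ->
  cylinders X J A -> cylinders X K B -> P (A `&` B) = (P A * P B)%E.
Proof.
move=> JK [C [mC CJ] <-] [D [mD DK] <-].
rewrite -big_split/= (indX (B := fun i => C i `&` D i)); last first.
  by move=> i; exact: measurableI.
rewrite !indX// -big_split/=; apply: eq_bigr => i _.
have := JK i; rewrite negb_and => /orP[/CJ|/DK] ->.
  by rewrite setTI preimage_setT probability_setT mul1e.
by rewrite setIT preimage_setT probability_setT mule1.
Qed.

(** For fixed [B] both sides are finite measures in [A], namely a restriction and a multiple of [P].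
    They agree on the cylinders, which contain [setT] and are closed under intersection. *)
Lemma independent_cylinders_sigma J B : measurable B ->
  (forall A, cylinders X J A -> P (A `&` B) = (P A * P B)%E) ->
  forall A, <<s cylinders X J >> A -> P (A `&` B) = (P A * P B)%E.
Proof.
move=> mB H A sA.
have fB : P B \is a fin_num by exact: fin_num_measure.
have pB0 : 0 <= fine (P B) by rewrite fine_ge0.
pose k := NngNum pB0.
have kE C : mscale k P C = (P C * P B)%E by rewrite /mscale/= fineK// muleC.
rewrite -kE; change (mrestr P mB A = mscale k P A).
apply: (g_sigma_algebra_measure_unique (cylinders X J)
  (@cylinders_measurable J) (fun=> setT)) sA => //.
- by move=> _; exact: cylindersT.
- by rewrite bigcup_const.
- exact: cylindersI.
- by move=> C CC; exact: (etrans (H _ CC) (esym (kE C))).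
- move=> _; change (P (setT `&` B) < +oo)%E; rewrite setTI.
  by rewrite (le_lt_trans (probability_le1 P mB))// ltry.
Qed.

Lemma independent_sigma J K A B : (forall i, ~~ (J i && K i)) ->
  <<s cylinders X J >> A -> <<s cylinders X K >> B ->
  P (A `&` B) = (P A * P B)%E.
Proof.
move=> JK sA sB; apply: (independent_cylinders_sigma (mT sB)) sA => C cC.
rewrite setIC muleC; apply: (independent_cylinders_sigma _) sB => [|D cD].
  exact: cylinders_measurable cC.
by rewrite setIC muleC; exact: independent_cylinders cC cD.
Qed.

(** Independence says that the law of the diagonal map into the product of the two
    sub-sigma-algebras is the product of their laws; Tonelli then gives the iterated integral. This
    is how one block is frozen while the other is integrated. *)
Lemma decoupling J K (H : g_sigma_algebraType (cylinders X J) *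
    g_sigma_algebraType (cylinders X K) -> \bar R) :
  (forall i, ~~ (J i && K i)) ->
  measurable_fun setT H -> (forall x, 0 <= H x)%E ->
  (\int[P]_w H (w, w) = \int[P]_w \int[P]_w' H (w, w'))%E.
Proof.
move=> JK mH H0.
set TJ := g_sigma_algebraType (cylinders X J).
set TK := g_sigma_algebraType (cylinders X K).
pose iJ : {mfun T >-> TJ} := HB.pack (id : T -> TJ)
  (isMeasurableFun.Build _ _ _ _ _ (@measurable_id_cylinders J)).
pose iK : {mfun T >-> TK} := HB.pack (id : T -> TK)
  (isMeasurableFun.Build _ _ _ _ _ (@measurable_id_cylinders K)).
have mD : measurable_fun setT ((fun w => (w, w)) : T -> TJ * TK).
  apply: measurable_fun_pair; exact: measurable_id_cylinders.
pose D : {mfun T >-> (TJ * TK)%type} := HB.pack ((fun w => (w, w)) : T -> TJ * TK)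
  (isMeasurableFun.Build _ _ _ _ _ mD).
transitivity (\int[distribution P D]_y H y)%E.
  by rewrite ge0_integral_distribution.
transitivity (\int[(distribution P iJ \x distribution P iK)%E]_y H y)%E.
  apply: eq_measure_integral => A mA _; apply/esym.
  apply: product_measure_unique => // B C mB mC.
  exact: independent_sigma.
rewrite fubini_tonelli1// ge0_integral_distribution//=.
- apply: eq_integral => w _; rewrite /fubini_F ge0_integral_distribution//.
  exact: measurableT_comp.
- exact: measurable_fun_fubini_tonelli_F.
- by move=> w; apply: integral_ge0.
Qed.

End decoupling.

(** * Gaussian families *)

Section product_expectation.
Context {dsp : measure_display} {T : measurableType dsp} {R : realType}.
Variables (P : probability T R) (I : finType) (X : I -> T -> R).
Hypothesis mX : forall i, measurable_fun setT (X i).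
Hypothesis indX : mutually_independent P X.
Local Open Scope ereal_scope.

(** Factors are split off one at a time, with blocks [i] and the rest of [s], disjoint because [s]
    has no repetition. Arbitrary lists allow a product over part of the variables, such as the noise
    entries alone. *)
Lemma expectation_prod (f : I -> R -> R) (s : seq I) : uniq s ->
  (forall i, measurable_fun setT (f i)) -> (forall i x, (0 <= f i x)%R) ->
  \int[P]_w (\prod_(i <- s) f i (X i w))%:E =
  \prod_(i <- s) \int[P]_w (f i (X i w))%:E.
Proof.
move=> us mf f0; elim: s us => [_|i s IH /= /andP[is_ us]].
  under eq_integral do rewrite big_nil.
  by rewrite big_nil integral_cst//= probability_setT mule1.
rewrite big_cons -IH//.
pose J : pred I := pred1 i; pose K : pred I := [pred j | j \in s].
pose H (p : g_sigma_algebraType (cylinders X J) * g_sigma_algebraType (cylinders X K)) :=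
  ((f i (X i p.1))%:E * (\prod_(j <- s) f j (X j p.2))%:E).
have p0 w : (0 <= \prod_(j <- s) f j (X j w))%R by apply: prodr_ge0.
transitivity (\int[P]_w H (w, w)).
  by apply: eq_integral => w _; rewrite big_cons EFinM.
rewrite (decoupling mX indX) /H/=; first last.
- by move=> x; rewrite mule_ge0// lee_fin.
- apply: emeasurable_funM; apply/measurable_EFinP.
    have mXi : measurable_fun setT (X i : g_sigma_algebraType (cylinders X J) -> R).
      by apply: measurable_fun_cylinders; exact: eqxx.
    exact: (measurableT_comp (mf i) (measurableT_comp mXi measurable_fst)).
  apply: measurable_prod => j js.
  have mXj : measurable_fun setT (X j : g_sigma_algebraType (cylinders X K) -> R).
    exact: measurable_fun_cylinders.
  exact: (measurableT_comp (mf j) (measurableT_comp mXj measurable_snd)).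
- by move=> j; rewrite /J /K/=; apply/negP => /andP[/eqP ->]; rewrite (negbTE is_).
have mp : measurable_fun setT (fun w => (\prod_(j <- s) f j (X j w))%:E).
  apply/measurable_EFinP; apply: measurable_prod => j _.
  exact: measurableT_comp (mf j) (mX j).
rewrite -ge0_integralZr//.
- apply: eq_integral => w _; rewrite ge0_integralZl//; last by rewrite lee_fin.
  by move=> ? _; rewrite lee_fin.
- by apply/measurable_EFinP; exact: measurableT_comp (mf i) (mX i).
- by move=> ? _; rewrite lee_fin.
- by apply: integral_ge0 => ? _; rewrite lee_fin.
Qed.

Lemma expectation_normal i (s : R) (f : measurableTypeR R -> \bar R) :
  (forall B, measurable B -> P (X i @^-1` B) = normal_prob 0 s B) ->
  measurable_fun setT f -> (forall x, 0 <= f x) ->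
  \int[P]_w f (X i w) = \int[normal_prob 0 s]_x f x.
Proof.
move=> Xi mf f0.
pose Y : {mfun T >-> measurableTypeR R} := HB.pack (X i : T -> measurableTypeR R)
  (isMeasurableFun.Build _ _ _ (measurableTypeR R) _ (mX i)).
rewrite -(ge0_integral_distribution (P := P) Y mf)//.
apply: eq_measure_integral => A mA _; exact: Xi.
Qed.

End product_expectation.

Definition gaussian_family {dsp : measure_display} {T : measurableType dsp}
    {R : realType} (P : probability T R) {I : finType} (X : I -> T -> R) : Prop :=
  [/\ forall i, measurable_fun setT (X i), mutually_independent P X &
      forall i (B : set R), measurable B -> P (X i @^-1` B) = normal_prob 0 1 B].

Section gaussian_family.
Context {dsp : measure_display} {T : measurableType dsp} {R : realType}.
Variables (P : probability T R).
Local Open Scope ereal_scope.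

(** A single product formula carries both the marginals and the independence, since the marginal at
    [i] appears when all other sets are [setT]. It is the form checked after a rotation. *)
Lemma gaussian_familyP (I : finType) (X : I -> T -> R) :
  gaussian_family P X <->
  (forall i, measurable_fun setT (X i)) /\
  (forall B : I -> set R, (forall i, measurable (B i)) ->
    P (\big[setI/setT]_(i : I) (X i @^-1` B i)) = \prod_(i : I) normal_prob 0 1 (B i)).
Proof.
split=> [[mX iX lX]|[mX E]].
  by split=> // B mB; rewrite iX//; apply: eq_bigr => i _; exact: lX.
have L i (B : set R) : measurable B -> P (X i @^-1` B) = normal_prob 0 1 B.
  move=> mB; have := E (fun j => if j == i then B else setT).
  rewrite (bigD1 i)//= eqxx big1 ?setIT; last first.
    by move=> j /negbTE ->; rewrite preimage_setT.
  rewrite (bigD1 i)//= eqxx big1 ?mule1; first by apply=> j; case: ifP.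
  by move=> j /negbTE ->; rewrite probability_setT.
by split=> // B mB; rewrite E//; apply: eq_bigr => i _; rewrite L.
Qed.

Lemma mutually_independent_sub (I J : finType) (f : J -> I) (X : I -> T -> R) :
  injective f -> mutually_independent P X -> mutually_independent P (X \o f).
Proof.
move=> fi iX B mB.
(* By injectivity, [C i] is [B j] when [i = f j], and [setT] outside the image of [f]. *)
pose C i : set R := \big[setI/setT]_(j | f j == i) B j.
have mC i : measurable (C i) by apply: bigsetI_measurable.
have CE i : P (X i @^-1` C i) = \prod_(j | f j == i) P (X (f j) @^-1` B j).
  rewrite /C; have [/codomP[k ->]|iNf] := boolP (i \in codom f).
    by rewrite !(big_pred1 k)// => j; rewrite /= (inj_eq fi).
  rewrite !big_pred0 ?preimage_setT ?probability_setT// => j;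
    by apply: contraNF iNf => /eqP <-; exact: codom_f.
rewrite (partition_big f xpredT)//= [RHS](partition_big f xpredT)//=.
under [RHS]eq_bigr => i _ do rewrite -CE.
rewrite -iX//; congr (P _); apply: eq_bigr => i _.
rewrite /C (big_morph _ (preimage_setI (X i)) (preimage_setT (X i))).
by apply: eq_bigr => j /eqP fj; rewrite /= fj.
Qed.

Lemma gaussian_family_sub (I J : finType) (f : J -> I) (X : I -> T -> R) :
  injective f -> gaussian_family P X -> gaussian_family P (X \o f).
Proof.
move=> fi [mX iX lX]; split => [j||j]; first exact: mX.
  exact: mutually_independent_sub.
exact: lX.
Qed.

(** Acting on bare functions lets the same rotation serve a family of variables, a row of a matrix
    and a vector. *)
Definition rotate2 (I : finType) (j k : I) (c s : R) (x : I -> R) : I -> R :=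
  fun i => (if i == j then c * x j + s * x k
            else if i == k then c * x k - s * x j else x i)%R.

(** A box for the rotated family is an event [S] on the two rotated coordinates, intersected with a
    box [Q] on the untouched ones, and these are independent. Decoupling [X j] from [X k] writes
    [P S] as a double normal integral, to which the planar invariance applies. *)
Lemma gaussian_family_rotate2 (I : finType) (j k : I) (c s : R) (X : I -> T -> R) :
  j != k -> (c ^+ 2 + s ^+ 2 = 1)%R -> s != 0%R ->
  gaussian_family P X ->
  gaussian_family P (fun i w => rotate2 j k c s (X ^~ w) i).
Proof.
move=> jk cs s0 [mX iX lX].
have kj : k != j by rewrite eq_sym.
have mfD (d : measure_display) (U : measurableType d) (f g : U -> R) (a b : R) :
    measurable_fun setT f -> measurable_fun setT g ->
    measurable_fun setT (fun w => a * f w + b * g w)%R.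
  by move=> mf mg; apply: measurable_funD; apply: measurable_funM.
have mfB (d : measure_display) (U : measurableType d) (f g : U -> R) (a b : R) :
    measurable_fun setT f -> measurable_fun setT g ->
    measurable_fun setT (fun w => a * f w - b * g w)%R.
  by move=> mf mg; apply: measurable_funB; apply: measurable_funM.
apply/gaussian_familyP; split.
  move=> i; rewrite /rotate2; case: (i == j); first exact: (mfD _ _ (X j) (X k)).
  by case: (i == k); [exact: (mfB _ _ (X k) (X j))|exact: mX].
move=> B mB.
pose S := [set w | B j (c * X j w + s * X k w)%R] `&` [set w | B k (c * X k w - s * X j w)%R].
pose J : pred I := pred2 j k; pose K : pred I := predC J.
have Jj : J j by rewrite /J/= eqxx.
have Jk : J k by rewrite /J/= eqxx orbT.
have Kj : K j = false by rewrite /K/= Jj.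
have Kk : K k = false by rewrite /K/= Jk.
pose Q := \big[setI/setT]_i (X i @^-1` (if K i then B i else setT)).
have -> : \big[setI/setT]_i ((fun w => rotate2 j k c s (X ^~ w) i) @^-1` B i) = S `&` Q.
  rewrite (bigD1 j)//= (bigD1 k)//= setIA; congr (_ `&` _ `&` _).
  - by apply/seteqP; split => w; rewrite /S/= /rotate2 eqxx.
  - by apply/seteqP; split => w; rewrite /S/= /rotate2 eqxx (negbTE kj).
  - rewrite /Q [RHS](bigD1 j)//= [in RHS](bigD1 k)//=.
    rewrite Kj Kk !preimage_setT !setTI.
    apply: eq_bigr => i /andP[/negbTE ij /negbTE ik].
    by rewrite /K/J/= ij ik/= /rotate2 ij ik.
have mfJ i : J i -> measurable_fun setT (X i : g_sigma_algebraType (cylinders X J) -> R).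
  exact: measurable_fun_cylinders.
rewrite (independent_sigma mX iX (J := J) (K := K)); last first.
- apply: sub_sigma_algebra; exists (fun i => if K i then B i else setT) => //.
  by split=> [i|i /negbTE ->//]; case: ifP.
- rewrite -[<<s _ >> S]/(measurable (S : set (g_sigma_algebraType (cylinders X J)))).
  apply: measurableI.
    have := @mfD _ _ _ _ c s (mfJ _ Jj) (mfJ _ Jk) measurableT _ (mB j).
    by rewrite setTI.
  have := @mfB _ _ _ _ c s (mfJ _ Jk) (mfJ _ Jj) measurableT _ (mB k).
  by rewrite setTI.
- by move=> i; rewrite /K/= andbN.
rewrite (bigD1 j)//= (bigD1 k)//= muleA; congr (_ * _); last first.
  rewrite /Q iX; last by move=> i; case: ifP.
  rewrite (bigD1 j)//= (bigD1 k)//= Kj Kk !preimage_setT.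
  rewrite !probability_setT !mul1e; apply: eq_bigr => i /andP[/negbTE ij /negbTE ik].
  by rewrite /K/J/= ij ik/= lX.
have mS : measurable S.
  apply: measurableI.
    by have := @mfD _ _ _ _ c s (mX j) (mX k) measurableT _ (mB j); rewrite setTI.
  by have := @mfB _ _ _ _ c s (mX k) (mX j) measurableT _ (mB k); rewrite setTI.
pose g (p : measurableTypeR R * measurableTypeR R) : \bar R :=
  ((\1_(B j) p.1)%:E * (\1_(B k) p.2)%:E).
have g0 p : 0 <= g p by rewrite mule_ge0// lee_fin.
have mg : measurable_fun setT g.
  apply: emeasurable_funM; apply/measurable_EFinP.
    exact: measurableT_comp (measurable_indic (mB j)) measurable_fst.
  exact: measurableT_comp (measurable_indic (mB k)) measurable_snd.
pose f (p : measurableTypeR R * measurableTypeR R) : \bar R :=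
  g ((c * p.1 + s * p.2)%R, (c * p.2 - s * p.1)%R).
have f0 p : 0 <= f p by exact: g0.
have mf : measurable_fun setT f.
  apply: measurableT_comp => //; apply: measurable_fun_pair => /=.
    exact: (mfD _ _ (fst : measurableTypeR R * measurableTypeR R -> R) snd).
  exact: (mfB _ _ (snd : measurableTypeR R * measurableTypeR R -> R) fst).
transitivity (\int[P]_w f (X j w, X k w)).
  transitivity (\int[P]_w (\1_S w)%:E); first by rewrite integral_indic// setIT.
  apply: eq_integral => w _; rewrite /f /g/= -EFinM; congr EFin.
  by rewrite !indicE -natrM mulnb /S in_setI; congr ((_ && _)%:R); apply/idP/idP; rewrite !inE.
pose J1 : pred I := pred1 j; pose K1 : pred I := pred1 k.
have mJ1 : measurable_fun setT (X j : g_sigma_algebraType (cylinders X J1) -> R).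
  by apply: measurable_fun_cylinders; exact: eqxx.
have mK1 : measurable_fun setT (X k : g_sigma_algebraType (cylinders X K1) -> R).
  by apply: measurable_fun_cylinders; exact: eqxx.
rewrite (decoupling mX iX (J := J1) (K := K1) (H := fun p => f (X j p.1, X k p.2)))//; last 2 first.
- by move=> i; rewrite /J1 /K1/=; apply/negP => /andP[/eqP ->]; rewrite (negbTE jk).
- apply: measurableT_comp => //; apply: measurable_fun_pair => /=.
    exact: measurableT_comp mJ1 measurable_fst.
  exact: measurableT_comp mK1 measurable_snd.
transitivity (\int[P]_w \int[normal_prob 0 1]_y f (X j w, y)).
  apply: eq_integral => w _.
  apply: (expectation_normal mX (lX k) (f := fun y => f (X j w, y))) => //.
  exact: measurableT_comp.
rewrite (expectation_normal mX (lX j) (f := fun x => \int[normal_prob 0 1]_y f (x, y)))//.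
- rewrite integral_normal_rotation//.
  have mI i : measurable_fun setT (fun y : measurableTypeR R => (\1_(B i) y)%:E : \bar R).
    apply/measurable_EFinP. exact: (measurable_indic (mB i)).
  have intI i : \int[normal_prob 0 1]_y (\1_(B i) y)%:E = normal_prob 0 1 (B i).
    by rewrite integral_indic ?setIT//; exact: mB.
  have I0 i (y : measurableTypeR R) : 0 <= (\1_(B i) y)%:E :> \bar R by rewrite lee_fin.
  transitivity (\int[normal_prob 0 1]_x ((\1_(B j) x)%:E * normal_prob 0 1 (B k))).
    apply: eq_integral => x _; rewrite -intI.
    rewrite /g/=.
    by apply: (@ge0_integralZl _ _ _ (normal_prob 0 1) setT measurableT _ (mI k)).
  rewrite -(intI j); apply: (@ge0_integralZr _ _ _ (normal_prob 0 1) setT measurableT _ (mI j)) => //.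
- exact: (measurable_fun_fubini_tonelli_F (m2 := normal_prob 0 1) f mf f0).
- by move=> x; exact: integral_ge0.
Qed.

End gaussian_family.

(** * Gaussian matrices *)

Lemma rotate2_dot {R : realType} (I : finType) (j k : I) (c s : R) (x y : I -> R) :
  j != k -> c ^+ 2 + s ^+ 2 = 1 ->
  \sum_i rotate2 j k c s x i * rotate2 j k c s y i = \sum_i x i * y i.
Proof.
move=> jk cs; have kj : k != j by rewrite eq_sym.
rewrite (bigD1 j)//= (bigD1 k)//= [RHS](bigD1 j)//= [in RHS](bigD1 k)//= !addrA.
congr (_ + _); last first.
  apply: eq_bigr => i /andP[/negbTE ij /negbTE ik].
  by rewrite /rotate2 ij ik.
rewrite /rotate2 !eqxx (negbTE kj) -[RHS]mul1r -cs; ring.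
Qed.

Section gaussian_matrix.
Context {dsp : measure_display} {T : measurableType dsp} {R : realType}.
Variables (P : probability T R).

Definition gaussian_matrix (k m : nat) (A : T -> 'M[R]_(k, m)) : Prop :=
  gaussian_family P (fun (p : 'I_k * 'I_m) w => A w p.1 p.2).

Lemma gaussian_matrix_rotate2 k m (A : T -> 'M[R]_(k, m)) (j l : 'I_m) (c s : R) :
  j != l -> c ^+ 2 + s ^+ 2 = 1 -> s != 0 -> gaussian_matrix A ->
  gaussian_matrix (fun w => \matrix_(i, h) rotate2 j l c s (A w i) h).
Proof.
move=> jl cs s0 gA.
(* Interpolation between [A] and the rotated matrix: only the first [N] rows are rotated, so each
   step changes two entries of one row. *)
pose X N (p : 'I_k * 'I_m) w :=
  if (p.1 < N)%N then rotate2 j l c s (A w p.1) p.2 else A w p.1 p.2.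
have gX N : gaussian_family P (X N).
  elim: N => [|N IH]; first exact: gA.
  have [Nk|kN] := ltnP N k; last first.
    have -> : X N.+1 = X N; last exact: IH.
    apply/funext => p; apply/funext => w; rewrite /X.
    by rewrite !(leq_trans (ltn_ord p.1))// ltnW.
  pose i0 := Ordinal Nk.
  have jl' : (i0, j) != (i0, l) by rewrite xpair_eqE eqxx.
  have := gaussian_family_rotate2 jl' cs s0 IH; congr gaussian_family.
  apply/funext => -[i h]; apply/funext => w.
  rewrite /X {1}/rotate2/= !xpair_eqE ltnn.
  have [->|ii0] := eqVneq i i0; first by rewrite /= ltnn ltnSn.
  have iN : (i == N :> nat) = false by apply: contraNF ii0 => /eqP iN; apply/eqP/val_inj.
  by rewrite /= (ltnS i N) (leq_eqVlt i N) iN.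
have := gX k; congr gaussian_family.
by apply/funext => p; apply/funext => w; rewrite /X ltn_ord mxE.
Qed.

(** [B] is [A] times an orthogonal matrix sending [v] to a multiple of the first basis vector,
    whence the equality of the Gram matrices of rows, which later recovers the norm of [A^T *m y].
    The scalar [e] is the norm of [v] up to sign. *)
Lemma gaussian_matrix_align k m (A : T -> 'M[R]_(k, m.+1)) (v : 'cV[R]_m.+1) :
  gaussian_matrix A ->
  exists (B : T -> 'M[R]_(k, m.+1)) (e : R),
  [/\ gaussian_matrix B, e ^+ 2 = \sum_i v i 0 ^+ 2,
      forall w, A w *m v = e *: col 0 (B w) &
      forall w, A w *m (A w)^T = B w *m (B w)^T].
Proof.
move=> gA.
(* Rotating columns [0] and [j] annihilates the [j]-th coordinate of [v]. *)
have H N : exists (B : T -> 'M[R]_(k, m.+1)) (u : 'cV[R]_m.+1),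
  [/\ gaussian_matrix B, \sum_i u i 0 ^+ 2 = \sum_i v i 0 ^+ 2,
      forall w, A w *m v = B w *m u,
      forall w, A w *m (A w)^T = B w *m (B w)^T &
      forall j : 'I_m.+1, (0 < j <= N)%N -> u j 0 = 0].
  elim: N => [|N [B [u [gB uv Au AB u0]]]].
    by exists A, v; split => // j; case: (nat_of_ord j).
  have [Nm|mN] := ltnP N.+1 m.+1; last first.
    exists B, u; split => // j /andP[j0 jN]; apply: u0; rewrite j0/=.
    by rewrite -ltnS (leq_trans (ltn_ord j)).
  pose j := Ordinal Nm.
  (* A coordinate that is already zero is skipped: its rotation would have [s = 0], which the
     rotation lemma excludes. *)
  have [uj|uj] := eqVneq (u j 0) 0.
    exists B, u; split => // i /andP[i0]; rewrite leq_eqVlt => /orP[/eqP iN|iN].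
      by rewrite (_ : i = j)//; exact: val_inj.
    by apply: u0; rewrite i0.
  pose r := Num.sqrt (u 0 0 ^+ 2 + u j 0 ^+ 2).
  have rr : r ^+ 2 = u 0 0 ^+ 2 + u j 0 ^+ 2.
    by rewrite sqr_sqrtr// addr_ge0// sqr_ge0.
  have r0 : r != 0.
    rewrite -sqrf_eq0 rr paddr_eq0 ?sqr_ge0// !sqrf_eq0 negb_and uj orbT.
    by [].
  pose c := u 0 0 / r; pose s := u j 0 / r.
  have cs : c ^+ 2 + s ^+ 2 = 1.
    by rewrite /c /s !expr_div_n -mulrDl -rr divff// sqrf_eq0.
  have s0 : s != 0 by rewrite mulf_neq0// invr_neq0.
  have j0 : ord0 != j by [].
  exists (fun w => \matrix_(i, h) rotate2 ord0 j c s (B w i) h),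
    (\col_h rotate2 ord0 j c s (u ^~ 0) h); split.
  - exact: gaussian_matrix_rotate2.
  - rewrite -uv; under eq_bigr do rewrite mxE expr2.
    by rewrite rotate2_dot//; apply: eq_bigr => h _; rewrite expr2.
  - move=> w; rewrite Au; apply/matrixP => i h; rewrite !mxE (ord1 h).
    by under [RHS]eq_bigr do rewrite !mxE; rewrite rotate2_dot.
  - move=> w; rewrite AB; apply/matrixP => i h; rewrite !mxE.
    under eq_bigr do rewrite mxE.
    by under [RHS]eq_bigr do rewrite !mxE; rewrite rotate2_dot.
  - move=> i /andP[i0 iN]; rewrite mxE /rotate2.
    have /negbTE -> : i != ord0 by rewrite -lt0n.
    have [_|ij] := eqVneq i j.
      by rewrite /c /s; field.
    apply: u0; rewrite i0/= -ltnS ltn_neqAle iN andbT.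
    by apply: contra ij => /eqP iN'; apply/eqP/val_inj.
have [B [u [gB uv Au AB u0]]] := H m.
have u0' i : i != 0 -> u i 0 = 0.
  by move=> i0; apply: u0; rewrite lt0n i0/= -ltnS ltn_ord.
exists B, (u 0 0); split => //.
  by rewrite -uv (bigD1 0)//= big1 ?addr0// => i /u0' ->; rewrite expr0n.
move=> w; rewrite Au; apply/matrixP => i h; rewrite !mxE (ord1 h) (bigD1 0)//= big1.
  by rewrite addr0 mulrC.
by move=> l /u0' ->; rewrite mulr0.
Qed.

End gaussian_matrix.

(** * Tail bounds *)

Section measurable_aux.
Context {dsp : measure_display} {T : measurableType dsp} {R : realType}.

Lemma measurable_fun_invr_ge0 (f : T -> R) :
  (forall x, 0 <= f x) -> measurable_fun setT f ->
  measurable_fun setT (fun x => (f x)^-1).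
Proof.
move=> f0 mf; rewrite (_ : (fun _ => _) = (@powR R ^~ (-1)) \o f).
  by apply: measurableT_comp => //; exact: measurable_powR.
by apply/funext => x /=; rewrite powR_inv1.
Qed.

Lemma measurable_fun_sqrtr_ge0 (f : T -> R) :
  (forall x, 0 <= f x) -> measurable_fun setT f ->
  measurable_fun setT (fun x => Num.sqrt (f x)).
Proof.
move=> f0 mf; rewrite (_ : (fun _ => _) = (@powR R ^~ (2^-1)) \o f).
  by apply: measurableT_comp => //; exact: measurable_powR.
by apply/funext => x /=; rewrite powR12_sqrt.
Qed.

Lemma measurable_sqr (f : T -> R) : measurable_fun setT f ->
  measurable_fun setT (fun x => f x ^+ 2).
Proof. exact: measurable_funX. Qed.

Lemma measurable_cstM (k : R) (f : T -> R) : measurable_fun setT f ->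
  measurable_fun setT (fun x => k * f x).
Proof. by move=> mf; apply: measurable_funM. Qed.

Variable P : probability T R.

(** Exponential Markov inequality: the indicator of [S] is at most [expR (g w)]. All three tail
    bounds start here. *)
Lemma probability_le_expR (S : set T) (g : T -> R) : measurable S -> measurable_fun setT g ->
  (forall w, S w -> 0 <= g w) -> (P S <= \int[P]_w (expR (g w))%:E)%E.
Proof.
move=> mS mg gS.
rewrite -[S in P S]setIT -integral_indic//.
apply: ge0_le_integral => //.
- by apply/measurable_EFinP; exact: measurable_indic.
- by apply/measurable_EFinP; exact: measurableT_comp.
- move=> w _; rewrite lee_fin indicE; case: (boolP (w \in S)) => [/set_mem/gS gw|_].
    by rewrite (le_trans _ (expR_ge1Dx _))// lerDl.
  exact: expR_ge0.
Qed.

End measurable_aux.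

Section tails.
Context {dsp : measure_display} {T : measurableType dsp} {R : realType}.
Variables (P : probability T R).

Lemma expectation_expR_sqr (I : finType) (X : I -> T -> R) (c : R) : c < 1 ->
  gaussian_family P X ->
  (\int[P]_w (expR (c * (\sum_i X i w ^+ 2) / 2))%:E =
   ((Num.sqrt (1 - c))^-1 ^+ #|I|)%:E)%E.
Proof.
move=> c1 [mX iX lX].
pose f (i : I) (x : R) := expR (c * x ^+ 2 / 2).
have mf i : measurable_fun setT (f i).
  apply: (@measurableT_comp _ _ _ _ _ _ expR) => //.
  by apply: measurable_funM => //; apply: measurable_funM => //; exact: measurable_sqr.
transitivity (\int[P]_w (\prod_(i <- index_enum I) f i (X i w))%:E)%E.
  apply: eq_integral => w _; rewrite -expR_sum; congr (expR _)%:E.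
  by rewrite mulr_sumr mulr_suml.
rewrite (expectation_prod mX iX)// ?index_enum_uniq//; last by move=> i x; exact: expR_ge0.
under eq_bigr => i _.
  rewrite (expectation_normal mX (lX i) (f := fun x => (f i x)%:E)); last 2 first.
  - by apply/measurable_EFinP; exact: mf.
  - by move=> x; rewrite lee_fin expR_ge0.
  rewrite integral_normal_expR_sqr//.
  over.
rewrite prodEFin; congr EFin.
by rewrite prodr_const.
Qed.

Lemma expR_pow_sqrtV (a : R) n : 0 < a ->
  (Num.sqrt a)^-1 ^+ n = expR (- (n%:R / 2) * ln a).
Proof.
move=> a0; rewrite -powR12_sqrt ?ltW// /powR gt_eqF// -expRN -expRM_natl.
by congr expR; field.
Qed.

Lemma tail_column (I : finType) (X : I -> T -> R) (tau : R) : 0 < tau < 1 ->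
  gaussian_family P X ->
  (P [set w | (\sum_i X i w ^+ 2 <= (1 - tau) * #|I|%:R)%R] <=
   (expR (#|I|%:R / 2 * (tau + ln (1 - tau))))%:E)%E.
Proof.
move=> /andP[t0 t1] gX; have [mX _ _] := gX.
have d0 : 0 < 1 - tau by rewrite subr_gt0.
(* Twice the Chernoff parameter: the value minimizing [(1 - tau) * x - ln (1 + x)], for which
   [1 + x] is the inverse of [1 - tau]. *)
pose x := tau / (1 - tau).
have x0 : 0 < x by rewrite divr_gt0.
have mS : measurable_fun setT (fun w => \sum_i X i w ^+ 2).
  by apply: measurable_sum => i; exact: measurable_sqr.
pose g w := tau * #|I|%:R / 2 + - x * (\sum_i X i w ^+ 2) / 2.
have mg : measurable_fun setT g.
  apply: measurable_funD => //; apply: measurable_funM => //; exact: measurable_cstM.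
apply: (le_trans (probability_le_expR P _ mg _)).
- by rewrite -[X in measurable X]setTI; exact: measurable_fun_le.
- move=> w /= Sw; rewrite /g -mulrDl divr_ge0// mulNr subr_ge0.
  rewrite /x mulrAC ler_pdivrMr// -mulrA ler_pM2l//.
  by rewrite mulrC.
rewrite /g; under eq_integral do rewrite expRD EFinM.
rewrite ge0_integralZl//; last first.
  apply/measurable_EFinP; apply: measurableT_comp => //.
  by apply: measurable_funM => //; exact: measurable_cstM.
rewrite expectation_expR_sqr//; last by rewrite (lt_trans _ ltr01)// oppr_lt0.
have -> : 1 - - x = (1 - tau)^-1 by rewrite /x; field; rewrite gt_eqF.
rewrite expR_pow_sqrtV ?invr_gt0// -EFinM -expRD lee_fin ler_expR lnV ?posrE//.
by rewrite le_eqVlt; apply/orP; left; apply/eqP; ring.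
Qed.

(* The left-hand side is the logarithm of the Chernoff bound for the event
   [(1 - tau) d / K2 * (|y|^2 + chi^2_m) >= |y|^2] with parameter
   [tau / (2 (1 - tau))], the one that is optimal for [|y|^2 <= (1 - tau) d]. *)
Lemma chernoff_rate_le (d m K2 tau : R) : 0 < d -> 0 <= m -> m + d <= K2 ->
  0 < tau < 1 ->
  - (m / 2) * ln (1 - tau * (d / K2)) +
  - (d / 2) * ln (1 + tau / (1 - tau) * (1 - (1 - tau) * d / K2)) <=
  d / 2 * (tau + ln (1 - tau)).
Proof.
move=> d0 m0 mdK /andP[t0 t1].
have K0 : 0 < K2 by rewrite (lt_le_trans _ mdK)// ltr_wpDl.
set p := d / K2.
have p0 : 0 < p by rewrite divr_gt0.
have p1 : p <= 1 by rewrite ler_pdivrMr// mul1r (le_trans _ mdK)// lerDr.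
have tp1 : tau * p < 1 by rewrite (le_lt_trans _ t1)// ler_piMr// ltW.
have s0 : 0 < 1 - tau by rewrite subr_gt0.
have q0 : 0 < 1 - tau * p by rewrite subr_gt0.
have r0 : 0 < 1 - tau * (1 - tau) * p.
  rewrite (lt_le_trans q0)// lerD2l lerN2 ler_wpM2r ?(ltW p0)//.
  by rewrite ler_piMr ?(ltW t0)// gerBl ltW.
(* The denominator [1 - tau] produces exactly the term [d / 2 * ln (1 - tau)] of the target. What
   remains is to bound the two other logarithms by [d / 2 * tau]. *)
have -> : 1 + tau / (1 - tau) * (1 - (1 - tau) * d / K2) =
    (1 - tau * (1 - tau) * p) / (1 - tau).
  by rewrite /p; field; rewrite !gt_eqF.
have pK : p * K2 = d by rewrite /p divfK// gt_eqF.
clearbody p; rewrite ln_div ?posrE//.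
have lnle (y : R) : y < 1 -> - ln (1 - y) <= y / (1 - y).
  move=> y1; have y0 : 0 < 1 - y by rewrite subr_gt0.
  rewrite -lnV ?posrE//.
  have {1}-> : (1 - y)^-1 = 1 + y / (1 - y) by field; rewrite gt_eqF.
  apply: le_ln1Dx; rewrite ltr_pdivlMr//; lra.
have h1 := lnle _ tp1.
(* The denominator is weakened to [1 - tau * p] to match the one in [h1]. *)
have h2 : - ln (1 - tau * (1 - tau) * p) <= tau * (1 - tau) * p / (1 - tau * p).
  apply: le_trans (lnle _ _) _; first by rewrite -subr_gt0.
  have z0 : 0 <= tau * (1 - tau) * p by rewrite ltW// !mulr_gt0.
  apply: (ler_wpM2l z0).
  rewrite lef_pV2 ?posrE// lerD2l lerN2 ler_wpM2r ?(ltW p0)//.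
  by rewrite ler_piMr ?(ltW t0)// gerBl ltW.
(* Once the common denominator is cleared, [d * tau ^+ 2 * p] cancels and the claim is
   [p * (m + d) <= d]. *)
have h3 : m * (tau * p / (1 - tau * p)) +
    d * (tau * (1 - tau) * p / (1 - tau * p)) <= d * tau.
  rewrite !mulrA -mulrDl ler_pdivrMr//.
  have h : p * (m + d) <= d.
    by rewrite -[leRHS]pK ler_wpM2l// ltW.
  have := ler_wpM2l (ltW t0) h; lra.
have h4 := ler_wpM2l m0 h1.
have h5 := ler_wpM2l (ltW d0) h2.
lra.
Qed.

Definition sqnorm {n : nat} (u : 'cV[R]_n) : R := \sum_i u i 0 ^+ 2.

Lemma sqnorm_ge0 n (u : 'cV[R]_n) : 0 <= sqnorm u.
Proof. by apply: sumr_ge0 => i _; exact: sqr_ge0. Qed.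

(** Aligning [y] with the first basis vector turns the quotient into the squared norm of one
    Gaussian column, a chi-square variable with [m] degrees of freedom. *)
Lemma expectation_expR_mulmx (m d : nat) (Z : T -> 'M[R]_(m, d)) (y : 'cV[R]_d)
    (c : R) : c < 1 -> sqnorm y != 0 -> gaussian_matrix P Z ->
  (\int[P]_w (expR (c * (sqnorm (Z w *m y) / sqnorm y) / 2))%:E =
   ((Num.sqrt (1 - c))^-1 ^+ m)%:E)%E.
Proof.
case: d Z y => [|d] Z y c1 y0 gZ; first by rewrite /sqnorm big_ord0 eqxx in y0.
have [B [e [gB eE Zy _]]] := gaussian_matrix_align y gZ.
have inj0 : injective (fun i : 'I_m => (i, ord0 : 'I_d.+1)) by move=> i j [].
have gB0 := gaussian_family_sub inj0 gB.
rewrite -[m in RHS]card_ord -(expectation_expR_sqr c1 gB0).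
apply: eq_integral => w _.
suff -> : sqnorm (Z w *m y) / sqnorm y = \sum_i B w i 0 ^+ 2 by [].
rewrite Zy -[X in _ / X]/(\sum_i y i 0 ^+ 2) -eE /sqnorm.
under eq_bigr do rewrite !mxE exprMn.
by rewrite -mulr_sumr mulrC mulKf// eE.
Qed.

(** The first entry of [A^T y] is [|y|^2], the others are inner products of [y] with the remaining
    columns. Integrating these columns first gives a factor [C] that does not depend on [y]; the
    integral over column [0] then leaves the quantity bounded in [chernoff_rate_le]. *)
Lemma tail_gram_col (d m : nat) (A : T -> 'M[R]_(d, m.+1)) (tau K2 : R) :
  (0 < d)%N -> (m + d)%:R <= K2 -> 0 < tau < 1 -> gaussian_matrix P A ->
  (P [set w | ((sqnorm (col 0 (A w)) != 0) &&
              (sqnorm (col 0 (A w)) ^+ 2 * K2 <=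
               (1 - tau) * d%:R * sqnorm ((A w)^T *m col 0 (A w))))%R] <=
   (expR (d%:R / 2 * (tau + ln (1 - tau))))%:E)%E.
Proof.
move=> d0 mdK tau01 gA; have /andP[t0 t1] := tau01; have [mA iA lA] := gA.
have s0 : 0 < 1 - tau by rewrite subr_gt0.
have dR0 : 0 < d%:R :> R by rewrite ltr0n.
have K0 : 0 < K2 by rewrite (lt_le_trans _ mdK)// ltr0n addn_gt0 d0 orbT.
(* [k] normalizes the inequality of the event to [Y <= k * (Y + Q / Y)]. *)
pose x := tau / (1 - tau); pose k := (1 - tau) * d%:R / K2.
have x0 : 0 < x by rewrite divr_gt0.
have k0 : 0 < k by rewrite divr_gt0// mulr_gt0.
have xkE : x * k = tau * (d%:R / K2).
  by rewrite /x /k; field; rewrite !gt_eqF.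
have xk1 : x * k < 1.
  rewrite xkE (le_lt_trans _ t1)// ler_piMr ?(ltW t0)//.
  by rewrite ler_pdivrMr// mul1r (le_trans _ mdK)// ler_nat leq_addl.
pose Y w := \sum_i A w i 0 ^+ 2.
(* The two arguments separate column [0], read at [w], from the other columns, read at [w']. *)
pose Q w w' := \sum_(j < m) (\sum_i A w i 0 * A w' i (lift 0 j)) ^+ 2.
have Y0 w : 0 <= Y w by apply: sumr_ge0 => i _; exact: sqr_ge0.
have nY w : sqnorm (col 0 (A w)) = Y w.
  by apply: eq_bigr => i _; rewrite mxE.
have nQ w : sqnorm ((A w)^T *m col 0 (A w)) = Y w ^+ 2 + Q w w.
  rewrite /sqnorm big_ord_recl; congr (_ + _).
    by rewrite mxE; congr (_ ^+ 2); apply: eq_bigr => i _; rewrite !mxE expr2.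
  apply: eq_bigr => j _; rewrite mxE; congr (_ ^+ 2); apply: eq_bigr => i _.
  by rewrite !mxE mulrC.
under [X in P X]eq_set do rewrite nY nQ.
pose I := ('I_d * 'I_m.+1)%type.
pose J : pred I := [pred p | p.2 == 0]; pose K : pred I := predC J.
pose TJ := g_sigma_algebraType (cylinders (fun (p : I) w => A w p.1 p.2) J).
pose TK := g_sigma_algebraType (cylinders (fun (p : I) w => A w p.1 p.2) K).
have mJ i : measurable_fun setT ((fun w => A w i 0) : TJ -> R).
  by apply: (measurable_fun_cylinders (i := (i, 0))); rewrite /J/= eqxx.
have mK i j : measurable_fun setT ((fun w => A w i (lift 0 j)) : TK -> R).
  by apply: (measurable_fun_cylinders (i := (i, lift 0 j))).
have mYJ : measurable_fun setT (Y : TJ -> R).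
  by apply: measurable_sum => i; exact: measurable_sqr.
have mQ : measurable_fun setT ((fun p => Q p.1 p.2) : TJ * TK -> R).
  apply: measurable_sum => j; apply: measurable_sqr; apply: measurable_sum => i.
  apply: measurable_funM.
    exact: measurableT_comp (mJ i) measurable_fst.
  exact: measurableT_comp (mK i j) measurable_snd.
have mY : measurable_fun setT Y.
  by apply: measurable_sum => i; apply: measurable_sqr; exact: (mA (i, 0)).
have mQT w : measurable_fun setT (Q w).
  apply: measurable_sum => j; apply: measurable_sqr; apply: measurable_sum => i.
  by apply: measurable_cstM; exact: (mA (i, lift 0 j)).
have mQD : measurable_fun setT (fun w => Q w w).
  apply: measurable_sum => j; apply: measurable_sqr; apply: measurable_sum => i.
  by apply: measurable_funM; [exact: (mA (i, 0))|exact: (mA (i, lift 0 j))].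
(* Equal to [x / 2 * (k * (Y + Q / Y) - Y)], hence nonnegative on the event. *)
pose g w w' := - (x * (1 - k)) * Y w / 2 + x * k * (Q w w' / Y w) / 2.
have mg : measurable_fun setT ((fun p => g p.1 p.2) : TJ * TK -> R).
  apply: measurable_funD.
    apply: measurable_funM => //; apply: measurable_cstM.
    exact: measurableT_comp mYJ measurable_fst.
  apply: measurable_funM => //; apply: measurable_cstM.
  apply: measurable_funM => //.
  apply: (@measurable_fun_invr_ge0 _ (TJ * TK)%type R (fun p => Y p.1)) => //.
  exact: measurableT_comp mYJ measurable_fst.
have mgD : measurable_fun setT (fun w => g w w).
  apply: measurable_funD.
    by apply: measurable_funM => //; exact: measurable_cstM.
  apply: measurable_funM => //; apply: measurable_cstM.
  by apply: measurable_funM => //; exact: measurable_fun_invr_ge0.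
apply: (le_trans (probability_le_expR P _ mgD _)).
- rewrite (_ : [set w | _] = (~` (Y @^-1` [set 0])) `&`
      [set w | Y w ^+ 2 * K2 <= (1 - tau) * d%:R * (Y w ^+ 2 + Q w w)]).
    apply: measurableI.
      apply: measurableC; rewrite -[X in measurable X]setTI; apply: mY => //.
    rewrite -[X in measurable X]setTI; apply: measurable_fun_le => //.
      by apply: measurable_funM => //; exact: measurable_sqr.
    by apply: measurable_cstM; apply: measurable_funD => //; exact: measurable_sqr.
  by apply/seteqP; split => w /= => [/andP[/eqP]|[/eqP ? ?]]//; apply/andP.
- move=> w /= /andP[Yn0 Sw].
  have Yp : 0 < Y w by rewrite lt_neqAle eq_sym Yn0 Y0.
  rewrite /g -mulrDl divr_ge0//.
  have -> : - (x * (1 - k)) * Y w + x * k * (Q w w / Y w) =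
     x * (k * (Y w ^+ 2 + Q w w) - Y w ^+ 2) / Y w by field; rewrite gt_eqF.
  rewrite divr_ge0// mulr_ge0 ?(ltW x0)// subr_ge0 /k mulrAC ler_pdivlMr//.
rewrite (decoupling mA iA (J := J) (K := K)
    (H := fun p => (expR (g p.1 p.2))%:E))/=; last 3 first.
- by move=> p; rewrite /K/= andbN.
- by apply/measurable_EFinP; exact: measurableT_comp.
- by move=> p; rewrite lee_fin expR_ge0.
pose C := (Num.sqrt (1 - x * k))^-1 ^+ m.
(* Where [Y w = 0], the quotient is [0] by convention and the inner integral is [1], so [C] must be
   at least [1]. *)
have C1 : 1 <= C.
  rewrite /C expR_pow_sqrtV ?subr_gt0// -[leLHS]expR0 ler_expR mulNr -mulrN.
  rewrite mulr_ge0 ?divr_ge0// oppr_ge0 ln_le0//.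
  by rewrite gerBl mulr_ge0 ?ltW.
have inner w : (\int[P]_w' (expR (x * k * (Q w w' / Y w) / 2))%:E <= C%:E)%E.
  have [Yw0|Yn0] := eqVneq (Y w) 0.
    rewrite Yw0 invr0; under eq_integral do rewrite !(mulr0, mul0r) expR0.
    by rewrite integral_cst//= mul1e probability_setT lee_fin.
  pose f (p : 'I_m * 'I_d) := (p.2, lift ord0 p.1 : 'I_m.+1).
  have fi : injective f.
    by move=> [a b] [a' b'] /eqP; rewrite xpair_eqE => /andP[/eqP/= -> /eqP/= /lift_inj ->].
  have gZ : gaussian_matrix P (fun w' => \matrix_(j < m, i < d) A w' i (lift ord0 j)).
    have := gaussian_family_sub fi gA; congr gaussian_family.
    by apply/funext => p; apply/funext => w'; rewrite /= mxE.
  have QE w' : Q w w' = sqnorm ((\matrix_(j < m, i < d) A w' i (lift ord0 j)) *m col 0 (A w)).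
    apply: eq_bigr => j _; rewrite mxE; congr (_ ^+ 2); apply: eq_bigr => i _.
    by rewrite !mxE mulrC.
  rewrite -nY in Yn0; under eq_integral do rewrite QE -nY.
  by rewrite expectation_expR_mulmx.
have mgw w : measurable_fun setT (fun w' => (expR (x * k * (Q w w' / Y w) / 2))%:E).
  apply/measurable_EFinP; apply: measurableT_comp => //.
  by apply: measurable_funM => //; apply: measurable_cstM; apply: measurable_funM.
have mgw' : measurable_fun setT (fun w => (expR (- (x * (1 - k)) * Y w / 2))%:E).
  apply/measurable_EFinP; apply: measurableT_comp => //.
  by apply: measurable_funM => //; exact: measurable_cstM.
have mg2 : measurable_fun setT (fun p : T * T => (expR (g p.1 p.2))%:E).
  apply/measurable_EFinP; apply: measurableT_comp => //.
  have mi : measurable_fun setT ((fun p => (p.1, p.2)) : T * T -> TJ * TK).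
    apply: measurable_fun_pair.
      exact: measurableT_comp (measurable_id_cylinders mA (J := J)) measurable_fst.
    exact: measurableT_comp (measurable_id_cylinders mA (J := K)) measurable_snd.
  exact: measurableT_comp mg mi.
apply: (@le_trans _ _ (\int[P]_w ((expR (- (x * (1 - k)) * Y w / 2))%:E * C%:E)))%E.
  apply: ge0_le_integral => //=.
  - by move=> w _; apply: integral_ge0 => w' _; rewrite lee_fin expR_ge0.
  - apply: (measurable_fun_fubini_tonelli_F (m2 := P) _ mg2) => p.
    by rewrite lee_fin expR_ge0.
  - by apply: emeasurable_funM.
  move=> w _.
  under eq_integral do rewrite /g expRD EFinM.
  rewrite ge0_integralZl//.
  by apply: lee_wpmul2l; [rewrite lee_fin expR_ge0|exact: inner].
rewrite ge0_integralZr//; last first.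
  by rewrite lee_fin (le_trans ler01).
have inj0 : injective (fun i : 'I_d => (i, ord0 : 'I_m.+1)) by move=> i j [].
have k1 : k < 1.
  rewrite /k -mulrA (lt_le_trans _ (_ : d%:R / K2 <= 1))//.
    by rewrite gtr_pMl ?divr_gt0// gtrBl.
  by rewrite ler_pdivrMr// mul1r (le_trans _ mdK)// ler_nat leq_addl.
have xk0 : 0 < x * (1 - k) by rewrite mulr_gt0// subr_gt0.
rewrite (expectation_expR_sqr _ (gaussian_family_sub inj0 gA)); last first.
  by rewrite (lt_trans _ ltr01)// oppr_lt0.
rewrite card_ord -EFinM lee_fin /C !expR_pow_sqrtV ?subr_gt0//; last first.
  by rewrite (lt_trans _ ltr01)// oppr_lt0.
rewrite -expRD ler_expR addrC opprK xkE.
apply: (@chernoff_rate_le d%:R m%:R K2 tau) => //.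
by rewrite -natrD.
Qed.

End tails.

(** * Projection of the noise on the random direction [A v] *)

Section noise.
Context {dsp : measure_display} {T : measurableType dsp} {R : realType}.
Variables (P : probability T R) (n d : nat).
Variables (A : T -> 'M[R]_(d, n)) (z : T -> 'cV[R]_d) (sigma : R).
Let X (k : ('I_d * 'I_n) + 'I_d) (w : T) : R :=
  match k with inl ij => A w ij.1 ij.2 | inr i => z w i 0 end.
Hypothesis sigma0 : 0 < sigma.
Hypothesis mX : forall k, measurable_fun setT (X k).
Hypothesis iX : mutually_independent P X.
Hypothesis lz : forall i (B : set R), measurable B ->
  P ((fun w => z w i 0) @^-1` B) = normal_prob 0 sigma B.

Lemma expectation_expR_noise (l : 'cV[R]_d) :
  (\int[P]_w (expR (\sum_i l i 0 * z w i 0))%:E =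
   (expR (sigma ^+ 2 / 2 * sqnorm l))%:E)%E.
Proof.
pose f (k : ('I_d * 'I_n) + 'I_d) (x : R) : R :=
  match k with inl _ => 1 | inr i => expR (l i 0 * x) end.
have mf k : measurable_fun setT (f k).
  case: k => [ij|i]; first exact: measurable_cst.
  by apply: (@measurableT_comp _ _ _ _ _ _ expR) => //; exact: measurable_cstM.
have f0 k x : 0 <= f k x by case: k => [?|?] /=; rewrite ?ler01 ?expR_ge0.
pose s := [seq inr i : ('I_d * 'I_n) + 'I_d | i <- index_enum 'I_d].
have us : uniq s by rewrite map_inj_uniq ?index_enum_uniq// => i j [].
transitivity (\int[P]_w (\prod_(k <- s) f k (X k w))%:E)%E.
  by apply: eq_integral => w _; rewrite expR_sum big_map.
rewrite (expectation_prod mX iX)// big_map.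
under eq_bigr => i _.
  rewrite (expectation_normal mX (i := inr i) (lz i) (f := fun x => (f (inr i) x)%:E)); last 2 first.
  - by apply/measurable_EFinP; exact: mf.
  - by move=> x; rewrite lee_fin; exact: f0.
  rewrite /f integral_normal_expR ?gt_eqF//.
  over.
rewrite prodEFin -expR_sum; congr (expR _)%:E.
by rewrite /sqnorm mulr_sumr; apply: eq_bigr => i _; ring.
Qed.

(** For [A] fixed, the projection of the noise on a unit vector is normal with standard deviation
    [sigma]; the resulting bound is free of [A] and survives the outer integration. *)
Lemma tail_noise (v : 'cV[R]_n) (gamma : R) : 0 < gamma ->
  (P [set w | ((sqnorm (A w *m v) != 0) &&
      (gamma * sigma * Num.sqrt (sqnorm (A w *m v)) <=
        - \sum_i (A w *m v) i 0 * z w i 0))%R] <=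
   (expR (- gamma ^+ 2 / 2))%:E)%E.
Proof.
move=> gamma0.
pose I := (('I_d * 'I_n) + 'I_d)%type.
pose J : pred I := fun k => if k is inl _ then true else false.
pose K : pred I := predC J.
pose TJ := g_sigma_algebraType (cylinders X J).
pose TK := g_sigma_algebraType (cylinders X K).
pose y (w : T) (i : 'I_d) : R := (A w *m v) i 0; pose Y (w : T) : R := sqnorm (A w *m v).
have Y0 w : 0 <= Y w by exact: sqnorm_ge0.
have myJ i : measurable_fun setT ((fun w => y w i) : TJ -> R).
  rewrite (_ : (fun _ => _) = fun w => \sum_j v j 0 * X (inl (i, j)) w).
    apply: measurable_sum => j; apply: measurable_cstM.
    exact: (@measurable_fun_cylinders _ T R _ X J (inl (i, j)) isT).
  by apply/funext => w; rewrite /y mxE; apply: eq_bigr => j _; rewrite mulrC.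
have my i : measurable_fun setT (fun w => y w i).
  exact: measurableT_comp (myJ i) (measurable_id_cylinders mX (J := J)).
have mYJ : measurable_fun setT (Y : TJ -> R).
  by apply: measurable_sum => i; exact: measurable_sqr (myJ i).
have mY : measurable_fun setT Y.
  exact: measurableT_comp mYJ (measurable_id_cylinders mX (J := J)).
have mzK i : measurable_fun setT ((fun w => z w i 0) : TK -> R).
  exact: (measurable_fun_cylinders (i := inr i)).
(* Chernoff parameter [gamma / sigma] along the direction [- y / |y|]: the exponent [- gamma ^+ 2]
   is half compensated by the moment generating function. *)
pose l w := \col_i (- (gamma / sigma) * (y w i / Num.sqrt (Y w))).
pose g (w w' : T) : R := - gamma ^+ 2 + \sum_i l w i 0 * z w' i 0.
have mg : measurable_fun setT ((fun p => g p.1 p.2) : TJ * TK -> R).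
  apply: measurable_funD => //; apply: measurable_sum => i.
  apply: measurable_funM; last exact: measurableT_comp (mzK i) measurable_snd.
  have ml : measurable_fun setT ((fun w => l w i 0) : TJ -> R).
    rewrite (_ : (fun _ => _) = fun w => - (gamma / sigma) * (y w i / Num.sqrt (Y w))).
      apply: measurable_cstM; apply: measurable_funM => //.
      apply: measurable_fun_invr_ge0; first by move=> w; exact: sqrtr_ge0.
      exact: measurable_fun_sqrtr_ge0.
    by apply/funext => w; rewrite mxE.
  exact: measurableT_comp ml measurable_fst.
have mi : measurable_fun setT ((fun w => (w, w)) : T -> TJ * TK).
  by apply: measurable_fun_pair; exact: measurable_id_cylinders.
have mi2 : measurable_fun setT ((fun p => (p.1, p.2)) : T * T -> TJ * TK).
  apply: measurable_fun_pair.
    exact: measurableT_comp (measurable_id_cylinders mX (J := J)) measurable_fst.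
  exact: measurableT_comp (measurable_id_cylinders mX (J := K)) measurable_snd.
have mgD : measurable_fun setT (fun w => g w w) by exact: measurableT_comp mg mi.
have gE w w' : g w w' = - gamma ^+ 2 - gamma / sigma * ((\sum_i y w i * z w' i 0) / Num.sqrt (Y w)).
  rewrite /g mulr_suml mulr_sumr -sumrN; congr (_ + _); apply: eq_bigr => i _.
  by rewrite mxE; ring.
pose S := [set w | ((Y w != 0) && (gamma * sigma * Num.sqrt (Y w) <=
        - \sum_i y w i * z w i 0))%R].
have mS : measurable S.
  rewrite (_ : S = (~` (Y @^-1` [set 0])) `&`
      [set w | gamma * sigma * Num.sqrt (Y w) <= - \sum_i y w i * z w i 0]).
    apply: measurableI.
      by apply: measurableC; rewrite -[X in measurable X]setTI; exact: mY.
    rewrite -[X in measurable X]setTI; apply: measurable_fun_le => //.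
      by apply: measurable_cstM; exact: measurable_fun_sqrtr_ge0.
    apply: measurableT_comp => //; apply: measurable_sum => i.
    by apply: measurable_funM; [exact: my|exact: (mX (inr i))].
  by apply/seteqP; split => w /= => [/andP[/eqP]|[/eqP ? ?]]//; apply/andP.
have gS w : ((Y w != 0) && (gamma * sigma * Num.sqrt (Y w) <=
        - \sum_i y w i * z w i 0))%R -> 0 <= g w w.
  move=> /andP[Yn0 Sw].
  have Yp : 0 < Num.sqrt (Y w) by rewrite sqrtr_gt0 lt_neqAle eq_sym Yn0 Y0.
  rewrite gE addrC subr_ge0 -mulrN -mulNr -ler_pdivrMl ?divr_gt0//.
  rewrite ler_pdivlMr//; apply: le_trans Sw; rewrite ler_pM2r//.
  by rewrite le_eqVlt; apply/orP; left; apply/eqP; field; rewrite !gt_eqF.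
apply: (@le_trans _ _ (\int[P]_w (expR (g w w))%:E)%E).
  exact: (probability_le_expR P mS mgD gS).
rewrite (decoupling mX iX (J := J) (K := K)
    (H := fun p => (expR (g p.1 p.2))%:E))/=; last 3 first.
- by move=> p; rewrite /K/= andbN.
- by apply/measurable_EFinP; exact: measurableT_comp.
- by move=> p; rewrite lee_fin expR_ge0.
have mgw w : measurable_fun setT (fun w' => (expR (\sum_i l w i 0 * z w' i 0))%:E).
  apply/measurable_EFinP; apply: measurableT_comp => //.
  by apply: measurable_sum => i; apply: measurable_cstM; exact: (mX (inr i)).
rewrite -[leRHS](_ : \int[P]_w (expR (- gamma ^+ 2 / 2))%:E = _)%E; last first.
  by rewrite integral_cst//= probability_setT mule1.
apply: ge0_le_integral => //=.
- by move=> w _; apply: integral_ge0 => w' _; rewrite lee_fin expR_ge0.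
- have mg2 : measurable_fun setT (fun p : T * T => (expR (g p.1 p.2))%:E).
    by apply/measurable_EFinP; apply: measurableT_comp => //; exact: measurableT_comp mg mi2.
  apply: (measurable_fun_fubini_tonelli_F (m2 := P) _ mg2) => p.
  by rewrite lee_fin expR_ge0.
move=> w _; under eq_integral do rewrite /g expRD EFinM.
rewrite ge0_integralZl//.
rewrite expectation_expR_noise -EFinM -expRD lee_fin ler_expR.
have -> : sqnorm (l w) = gamma ^+ 2 / sigma ^+ 2 * (Y w / Y w).
  rewrite /sqnorm; under eq_bigr do rewrite mxE exprMn expr_div_n sqr_sqrtr//.
  rewrite -mulr_sumr -mulr_suml sqrrN expr_div_n; congr (_ * (_ / _)).
(* The quotient is [0] rather than [1] when [y] vanishes; the inequality covers both cases. *)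
have YY : Y w / Y w <= 1.
  by have [->|Yn0] := eqVneq (Y w) 0; rewrite ?invr0 ?mulr0 ?ler01// divff.
have -> : sigma ^+ 2 / 2 * (gamma ^+ 2 / sigma ^+ 2 * (Y w / Y w)) = gamma ^+ 2 / 2 * (Y w / Y w).
  by move: (Y w / Y w) => q; field; rewrite gt_eqF.
have g2 : 0 <= gamma ^+ 2 / 2 by rewrite divr_ge0// sqr_ge0.
have := ler_wpM2l g2 YY; lra.
Qed.

End noise.

(** * Deterministic analysis of a decoding error *)

Section euclidean.
Context {R : realType}.

Definition dotv {n} (u v : 'cV[R]_n) : R := \sum_i u i 0 * v i 0.

Lemma norm2E n (u : 'cV[R]_n) : norm2 u = Num.sqrt (sqnorm u).
Proof. by []. Qed.

Lemma sqr_norm2 n (u : 'cV[R]_n) : norm2 u ^+ 2 = sqnorm u.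
Proof. by rewrite norm2E sqr_sqrtr// sqnorm_ge0. Qed.

Lemma norm2_ge0 n (u : 'cV[R]_n) : 0 <= norm2 u.
Proof. exact: sqrtr_ge0. Qed.

Lemma sqnormN n (u : 'cV[R]_n) : sqnorm (- u) = sqnorm u.
Proof. by apply: eq_bigr => i _; rewrite mxE sqrrN. Qed.

Lemma sqnormD n (u v : 'cV[R]_n) :
  sqnorm (u + v) = sqnorm u + 2 * dotv u v + sqnorm v.
Proof.
rewrite /sqnorm /dotv mulr_sumr -!big_split/=; apply: eq_bigr => i _.
by rewrite mxE; ring.
Qed.

Lemma dotvD n (u v w : 'cV[R]_n) : dotv u (v + w) = dotv u v + dotv u w.
Proof. by rewrite -big_split/=; apply: eq_bigr => i _; rewrite mxE mulrDr. Qed.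

Lemma dotv_tr m n (M : 'M[R]_(m, n)) u v : dotv u (M *m v) = dotv (M^T *m u) v.
Proof.
rewrite /dotv; under eq_bigr do rewrite mxE mulr_sumr.
rewrite exchange_big/=; apply: eq_bigr => j _; rewrite mxE mulr_suml.
by apply: eq_bigr => i _; rewrite mxE; ring.
Qed.

Lemma cauchy_schwarz n (u v : 'cV[R]_n) : `|dotv u v| <= norm2 u * norm2 v.
Proof.
have H : dotv u v ^+ 2 <= sqnorm u * sqnorm v.
  have [v0|v0] := eqVneq (sqnorm v) 0.
    have vi i : v i 0 = 0.
      move/eqP: v0.
      rewrite psumr_eq0 => [/allP/(_ i (mem_index_enum _))|j _]; last exact: sqr_ge0.
      by rewrite /= sqrf_eq0 => /eqP.
    by rewrite v0 mulr0 /dotv big1 ?expr0n// => i _; rewrite vi mulr0.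
  have vp : 0 < sqnorm v by rewrite lt_neqAle eq_sym v0 sqnorm_ge0.
  have := sqnorm_ge0 (sqnorm v *: u - dotv u v *: v).
  have E (a b : R) : sqnorm (a *: u - b *: v) =
      a ^+ 2 * sqnorm u - 2 * a * b * dotv u v + b ^+ 2 * sqnorm v.
    rewrite /sqnorm /dotv !mulr_sumr -sumrN -!big_split/=.
    by apply: eq_bigr => i _; rewrite !mxE; ring.
  have -> : sqnorm (sqnorm v *: u - dotv u v *: v) =
      sqnorm v * (sqnorm u * sqnorm v - dotv u v ^+ 2) by rewrite E; ring.
  by rewrite pmulr_rge0// subr_ge0.
rewrite -[leRHS]ger0_norm ?mulr_ge0 ?norm2_ge0// -ler_sqr ?nnegrE//.
by rewrite !real_normK ?num_real// exprMn !sqr_norm2.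
Qed.

Lemma norm2D n (u v : 'cV[R]_n) : norm2 (u + v) <= norm2 u + norm2 v.
Proof.
rewrite -ler_sqr ?nnegrE ?addr_ge0 ?norm2_ge0// sqr_norm2 sqnormD sqrrD !sqr_norm2.
by have := le_trans (ler_norm _) (cauchy_schwarz u v); lra.
Qed.

(** If all three cases fail, multiplying the minimality inequality by [D * norm2 v] lets the second
    case bound the term in [delta] and the first and third bound the noise. The outcome is [|y|^2 *
    D * |v| < |y|^2 * (2 * K * delta + 2 * gs)], while a large error forces [D * |v|] to be at least
    that last factor. *)
Lemma decoding_error_cases (m n : nat) (A : 'M[R]_(m, n)) (z : 'cV[R]_m)
    (x c c' : 'cV[R]_n) (delta K D gs : R) :
  0 < K -> 0 < gs -> 0 < D -> norm2 (x - c) <= delta ->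
  sqnorm (A *m x + z - A *m c') <= sqnorm (A *m x + z - A *m c) ->
  (2 * K * delta + 2 * gs) / D + delta <= norm2 (x - c') ->
  let v := c - c' in let y := A *m v in
  sqnorm v != 0 /\
  [\/ sqnorm y <= D ^+ 2 * sqnorm v,
      (sqnorm y != 0) && (sqnorm y ^+ 2 * K ^+ 2 <= D ^+ 2 * sqnorm (A^T *m y) * sqnorm v) |
      (sqnorm y != 0) && (gs * Num.sqrt (sqnorm y) <= - \sum_i y i 0 * z i 0)].
Proof.
move=> K0 gs0 D0 xc opt err v y.
have delta0 : 0 <= delta by rewrite (le_trans _ xc)// norm2_ge0.
pose M := 2 * K * delta + 2 * gs.
have M0 : 0 < M by rewrite /M ltr_wpDl ?mulr_ge0 ?mulr_gt0 ?(ltW K0).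
(* The triangle inequality through [c] uses up the additive [delta] of the threshold. *)
have vM : M <= D * norm2 v.
  rewrite mulrC -ler_pdivrMr//.
  have : norm2 (x - c') <= norm2 (x - c) + norm2 v.
    by apply: le_trans (norm2D _ _); rewrite addrA subrK.
  by rewrite -/M in err; lra.
have Dv0 : 0 < D * norm2 v by rewrite (lt_le_trans M0).
have v0 : 0 < norm2 v by move: Dv0; rewrite pmulr_rgt0.
split; first by rewrite -sqr_norm2 gt_eqF// exprn_gt0.
have [|small] := leP (sqnorm y) (D ^+ 2 * sqnorm v); first by constructor 1.
have y2 : 0 < sqnorm y.
  by apply: le_lt_trans small; rewrite mulr_ge0 ?sqr_ge0 ?sqnorm_ge0.
rewrite gt_eqF//=.
have [|gram] := leP (sqnorm y ^+ 2 * K ^+ 2) (D ^+ 2 * sqnorm (A^T *m y) * sqnorm v).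
  by constructor 2.
have [|noise] := leP (gs * Num.sqrt (sqnorm y)) (- \sum_i y i 0 * z i 0).
  by constructor 3.
exfalso.
have ny0 : 0 <= norm2 y by exact: norm2_ge0.
have small' : D * norm2 v < norm2 y.
  by rewrite -ltr_sqr ?nnegrE ?(ltW Dv0)// exprMn !sqr_norm2.
have gram' : norm2 (A^T *m y) * (D * norm2 v) <= sqnorm y * K.
  rewrite -ler_sqr ?nnegrE ?mulr_ge0 ?norm2_ge0 ?(ltW D0) ?(ltW K0) ?(ltW y2)//.
  rewrite !exprMn !sqr_norm2; apply: ltW; apply: le_lt_trans gram.
  by rewrite le_eqVlt; apply/orP; left; apply/eqP; ring.
(* The residuals at [c] and [c'] are [e] and [y + e], so minimality reads [|y|^2 <= - 2 <y, e>].
   Moving [A] to the other side of the inner product leaves only the norm of [A^T *m y] to pair with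
   [delta]. *)
have main : sqnorm y <= 2 * (norm2 (A^T *m y) * delta) + 2 * - dotv y z.
  pose e := A *m (x - c) + z.
  have e1 : A *m x + z - A *m c = e by rewrite /e mulmxBr addrAC.
  have e2 : A *m x + z - A *m c' = y + e.
    by rewrite /y /e /v !mulmxBr; apply/matrixP => i j; rewrite !mxE; ring.
  move: opt; rewrite e1 e2 sqnormD /e dotvD dotv_tr => opt.
  have cs := cauchy_schwarz (A^T *m y) (x - c).
  have : - dotv (A^T *m y) (x - c) <= norm2 (A^T *m y) * delta.
    rewrite (le_trans (ler_norm _))// normrN (le_trans cs)//.
    by rewrite ler_wpM2l// norm2_ge0.
  by lra.
have noise' : - dotv y z < gs * norm2 y by [].
have yy : sqnorm y = norm2 y * norm2 y by rewrite -sqr_norm2 expr2.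
set G := norm2 (A^T *m y) in gram' main; set Dv := D * norm2 v in vM Dv0 small' gram'.
set N := norm2 y in ny0 small' noise' yy.
have a1 : sqnorm y * Dv < (2 * (G * delta) + 2 * (gs * N)) * Dv.
  by rewrite ltr_pM2r//; lra.
have a2 : G * Dv * delta <= sqnorm y * K * delta by rewrite ler_wpM2r.
have a3 : gs * N * Dv <= gs * N * N by rewrite ler_wpM2l ?(ltW small')// mulr_ge0// ltW.
have a4 : sqnorm y * M <= sqnorm y * Dv by rewrite ler_wpM2l// ltW.
move: a1 a2 a3 a4; rewrite /M yy; lra.
Qed.

End euclidean.

(** * Union bound *)

(** A supremum dominates its set only if the set is bounded above. Here compactness bounds each
    coordinate on [Q], there are finitely many codewords, and the Euclidean norm is at most the sum
    of the absolute coordinates. *)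
Lemma le_distortion {R : realType} (n r : nat) (Q : set 'cV[R]_n)
    (enc : 'cV[R]_n -> 'I_(2 ^ r)) (dec : 'I_(2 ^ r) -> 'cV[R]_n) x :
  compact Q -> Q x -> norm2 (x - dec (enc x)) <= distortion Q enc dec.
Proof.
move=> cQ Qx; apply: ub_le_sup; last by exists x.
have bnd (i : 'I_n) : exists M : R, forall y, Q y -> `|y i 0| <= M.
  have : compact ((fun y : 'cV[R]_n => y i 0) @` Q).
    apply: continuous_compact => //; apply: continuous_subspaceT.
    exact: coord_continuous.
  move=> /(@compact_bounded _ R^o)[M [_ HM]].
  exists (M + 1) => y Qy; apply: (HM (M + 1)); first by rewrite ltrDl.
  by exists y.
have [M HM] := choice bnd.
exists (\sum_i (M i + \sum_k `|dec k i 0|)) => _ [y Qy <-].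
have T0 i : 0 <= M i + \sum_k `|dec k i 0|.
  rewrite addr_ge0//; last exact: sumr_ge0.
  exact: le_trans (normr_ge0 _) (HM i x Qx).
have le1 i : `|(y - dec (enc y)) i 0| <= M i + \sum_k `|dec k i 0|.
  rewrite !mxE (le_trans (ler_normB _ _))// lerD ?HM//.
  by rewrite (bigD1 (enc y))//= lerDl sumr_ge0.
rewrite -ler_sqr ?nnegrE ?norm2_ge0//; last exact: sumr_ge0.
rewrite sqr_norm2 expr2 mulr_suml; apply: ler_sum => i _.
rewrite -real_normK ?num_real// expr2 ler_pM//.
apply: (le_trans (le1 i)).
by rewrite (bigD1 i)//= lerDl sumr_ge0.
Qed.

Section union_bound.
Context {dsp : measure_display} {T : measurableType dsp} {R : realType}.
Variables (P : probability T R).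

Lemma measure_bigsetU_le_card (I : finType) (Q : pred I) (F : I -> set T) (c : R) :
  (forall i, Q i -> measurable (F i)) ->
  (forall i, Q i -> (P (F i) <= c%:E)%E) ->
  (P (\big[setU/set0]_(i | Q i) F i) <= (#|Q|%:R * c)%:E)%E.
Proof.
move=> mF Fc; rewrite -sum1_card natr_sum mulr_suml.
rewrite -sumEFin; under [leRHS]eq_bigr do rewrite mul1r.
elim: (index_enum I) => [|i s IH]; first by rewrite !big_nil measure0.
rewrite !big_cons unfold_in; case: ifP => Qi //.
apply: le_trans (measureU2 _ _ _) _; [exact: mF| |].
  by apply: bigsetU_measurable => j; exact: mF.
exact: (leeD (Fc _ Qi) IH).
Qed.

End union_bound.

(** Swapping the components injects these pairs into their complement. The doubling pays for two
    events per unordered pair. *)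
Lemma card_ltn_pairs N : (#|[pred p : 'I_N * 'I_N | (p.1 < p.2)%N]|.*2 <= N * N)%N.
Proof.
set L := [pred p : 'I_N * 'I_N | (p.1 < p.2)%N].
pose sw (p : 'I_N * 'I_N) := (p.2, p.1).
have swi : injective sw by move=> [a b] [a' b'] [-> ->].
rewrite -[X in (_ <= X * _)%N]card_ord -[X in (_ <= _ * X)%N]card_ord -card_prod.
rewrite -(cardC L) -addnn leq_add2l -(fintype.card_image swi).
apply: subset_leq_card; apply/fintype.subsetP => _ /fintype.imageP[[a b] Lab ->].
by rewrite !inE/= -leqNgt ltnW.
Qed.

(** * Bad events attached to an arbitrary direction *)

Section general_direction.
Context {dsp : measure_display} {T : measurableType dsp} {R : realType}.
Variables (P : probability T R) (n d : nat) (A : T -> 'M[R]_(d, n)).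
Variable tau : R.
Hypothesis gA : gaussian_matrix P A.

Lemma measurable_mulmx_col (v : 'cV[R]_n) i :
  measurable_fun setT (fun w => (A w *m v) i 0).
Proof.
have [mA _ _] := gA.
rewrite (_ : (fun _ => _) = fun w => \sum_j v j 0 * A w i j).
  by apply: measurable_sum => j; apply: measurable_cstM; exact: (mA (i, j)).
by apply/funext => w; rewrite mxE; apply: eq_bigr => j _; rewrite mulrC.
Qed.

Lemma measurable_sqnorm_mulmx (v : 'cV[R]_n) :
  measurable_fun setT (fun w => sqnorm (A w *m v)).
Proof.
by apply: measurable_sum => i; apply: measurable_sqr; exact: measurable_mulmx_col.
Qed.

Lemma measurable_sqnorm_gram (v : 'cV[R]_n) :
  measurable_fun setT (fun w => sqnorm ((A w)^T *m (A w *m v))).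
Proof.
have [mA _ _] := gA.
apply: measurable_sum => j; apply: measurable_sqr.
rewrite (_ : (fun _ => _) = fun w => \sum_i A w i j * (A w *m v) i 0).
  apply: measurable_sum => i; apply: measurable_funM; first exact: (mA (i, j)).
  exact: measurable_mulmx_col.
by apply/funext => w; rewrite mxE; apply: eq_bigr => i _; rewrite mxE.
Qed.

Lemma measurable_neq0 (f : T -> R) : measurable_fun setT f ->
  measurable [set w | f w != 0].
Proof.
move=> mf; rewrite (_ : [set w | _] = ~` (f @^-1` [set 0])).
  by apply: measurableC; rewrite -[X in measurable X]setTI; exact: mf.
by apply/seteqP; split => w /= /eqP.
Qed.

Definition small_event (v : 'cV[R]_n) : set T :=
  [set w | sqnorm (A w *m v) <= (1 - tau) * d%:R * sqnorm v].

(** Both sides have degree four in [v], so the event is invariant under scaling. The points with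
    [A w *m v = 0], where the inequality reads [0 <= 0], are left to [small_event]. *)
Definition gram_event (K2 : R) (v : 'cV[R]_n) : set T :=
  [set w | (sqnorm (A w *m v) != 0) && (sqnorm (A w *m v) ^+ 2 * K2 <=
    (1 - tau) * d%:R * sqnorm ((A w)^T *m (A w *m v)) * sqnorm v)].

Lemma small_eventN v : small_event (- v) = small_event v.
Proof. by apply/seteqP; split=> w; rewrite /small_event/= mulmxN !sqnormN. Qed.

Lemma gram_eventN K2 v : gram_event K2 (- v) = gram_event K2 v.
Proof. by apply/seteqP; split=> w; rewrite /gram_event/= !mulmxN !sqnormN. Qed.

Lemma measurable_small_event v : measurable (small_event v).
Proof.
rewrite -[X in measurable X]setTI; apply: measurable_fun_le => //.
exact: measurable_sqnorm_mulmx.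
Qed.

Lemma measurable_gram_event K2 v : measurable (gram_event K2 v).
Proof.
rewrite (_ : gram_event K2 v = [set w | sqnorm (A w *m v) != 0] `&`
    [set w | sqnorm (A w *m v) ^+ 2 * K2 <=
      (1 - tau) * d%:R * sqnorm ((A w)^T *m (A w *m v)) * sqnorm v]).
  apply: measurableI; first exact/measurable_neq0/measurable_sqnorm_mulmx.
  rewrite -[X in measurable X]setTI; apply: measurable_fun_le => //.
    by apply: measurable_funM => //; apply: measurable_sqr; exact: measurable_sqnorm_mulmx.
  by apply: measurable_funM => //; apply: measurable_cstM; exact: measurable_sqnorm_gram.
by apply/seteqP; split => w /= => [/andP|[? ?]]//; apply/andP.
Qed.

End general_direction.

Lemma sqnormZ {R : realType} n (a : R) (u : 'cV[R]_n) :
  sqnorm (a *: u) = a ^+ 2 * sqnorm u.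
Proof.
by rewrite /sqnorm mulr_sumr; apply: eq_bigr => i _; rewrite mxE exprMn.
Qed.

(** The squared norm is the quadratic form of [M *m M^T] at [u], and this matrix is preserved by the
    alignment. *)
Lemma sqnorm_tr_mulmx {R : realType} m n (M N : 'M[R]_(m, n)) (u : 'cV[R]_m) :
  M *m M^T = N *m N^T -> sqnorm (M^T *m u) = sqnorm (N^T *m u).
Proof.
have E (L : 'M[R]_(m, n)) : sqnorm (L^T *m u) = dotv u (L *m L^T *m u).
  rewrite -mulmxA dotv_tr /sqnorm /dotv.
  by apply: eq_bigr => i _; rewrite expr2.
by move=> MN; rewrite !E MN.
Qed.

Section general_tails.
Context {dsp : measure_display} {T : measurableType dsp} {R : realType}.
Variables (P : probability T R) (n d : nat) (A : T -> 'M[R]_(d, n)).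
Variables (tau : R) (v : 'cV[R]_n).
Hypothesis tau01 : 0 < tau < 1.
Hypothesis v0 : sqnorm v != 0.
Local Notation rate := (expR (d%:R / 2 * (tau + ln (1 - tau)))).

Lemma tail_small : gaussian_matrix P A -> (P (small_event A tau v) <= rate%:E)%E.
Proof.
case: n A v v0 => [|m] B u u0 gB; first by rewrite /sqnorm big_ord0 eqxx in u0.
have up : 0 < sqnorm u by rewrite lt_neqAle eq_sym u0 sqnorm_ge0.
have [C [e [gC eE Bu _]]] := gaussian_matrix_align u gB.
have inj0 : injective (fun i : 'I_d => (i, ord0 : 'I_m.+1)) by move=> i j [].
have := tail_column tau01 (gaussian_family_sub inj0 gC).
rewrite card_ord; congr (P _ <= _)%E; apply/funext => w /=; apply/propext.
rewrite /small_event/= Bu sqnormZ eE -/(sqnorm u).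
rewrite (mulrC _ (sqnorm u)) ler_pM2l//.
suff -> : sqnorm (col 0 (C w)) = \sum_i C w i 0 ^+ 2 by [].
by apply: eq_bigr => i _; rewrite mxE.
Qed.

Lemma tail_gram (K2 : R) : (0 < d)%N -> (n + d)%:R <= K2 ->
  gaussian_matrix P A -> (P (gram_event A tau K2 v) <= rate%:E)%E.
Proof.
move=> d0; case: n A v v0 => [|m] B u u0 ndK gB.
  by rewrite /sqnorm big_ord0 eqxx in u0.
have up : 0 < sqnorm u by rewrite lt_neqAle eq_sym u0 sqnorm_ge0.
have [C [e [gC eE Bu BC]]] := gaussian_matrix_align u gB.
have mdK : (m + d)%:R <= K2 by apply: le_trans ndK; rewrite ler_nat addSn.
have := tail_gram_col d0 mdK tau01 gC.
congr (P _ <= _)%E; apply/funext => w /=; apply/propext.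
rewrite /gram_event/= (sqnorm_tr_mulmx _ (BC w)) Bu -scalemxAr !sqnormZ eE -/(sqnorm u).
rewrite mulf_eq0 (negbTE u0)/= exprMn.
set a := sqnorm (col 0 (C w)); set b := sqnorm _; set k := sqnorm u.
have -> : k ^+ 2 * a ^+ 2 * K2 = k ^+ 2 * (a ^+ 2 * K2) by ring.
have -> : (1 - tau) * d%:R * (k * b) * k = k ^+ 2 * ((1 - tau) * d%:R * b) by ring.
by rewrite ler_pM2l ?exprn_gt0.
Qed.

End general_tails.

Definition noise_event {T : Type} {R : realType} {n d : nat} (A : T -> 'M[R]_(d, n))
    (z : T -> 'cV[R]_d) (gs : R) (v : 'cV[R]_n) : set T :=
  [set w | (sqnorm (A w *m v) != 0) && (gs * Num.sqrt (sqnorm (A w *m v)) <=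
    - \sum_i (A w *m v) i 0 * z w i 0)].

Lemma measurable_noise_event {dsp : measure_display} {T : measurableType dsp}
    {R : realType} (P : probability T R) (n d : nat) (A : T -> 'M[R]_(d, n))
    (z : T -> 'cV[R]_d) (gs : R) (v : 'cV[R]_n) :
  gaussian_matrix P A -> (forall i, measurable_fun setT (fun w => z w i 0)) ->
  measurable (noise_event A z gs v).
Proof.
move=> gA mz.
rewrite (_ : noise_event A z gs v = [set w | sqnorm (A w *m v) != 0] `&`
    [set w | gs * Num.sqrt (sqnorm (A w *m v)) <= - \sum_i (A w *m v) i 0 * z w i 0]).
  apply: measurableI; first exact: (measurable_neq0 (measurable_sqnorm_mulmx gA v)).
  rewrite -[X in measurable X]setTI; apply: measurable_fun_le => //.
    apply: measurable_cstM; apply: measurable_fun_sqrtr_ge0.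
      by move=> w; exact: sqnorm_ge0.
    exact: (measurable_sqnorm_mulmx gA).
  apply: measurableT_comp => //; apply: measurable_sum => i.
  by apply: measurable_funM => //; exact: (measurable_mulmx_col gA).
by apply/seteqP; split => w /= => [/andP|[? ?]]//; apply/andP.
Qed.

(** The failure set quantifies over all of [Q] and over the choice of minimizer; the cover [E] is a
    finite union of events on differences of codewords, hence measurable. *)
Theorem theorem8 (R : realType) (n d r : nat) (Q : set 'cV[R]_n)
  (enc : 'cV[R]_n -> 'I_(2 ^ r)) (dec : 'I_(2 ^ r) -> 'cV[R]_n) (delta : R)
  (sigma : R) (dsp : measure_display) (T : measurableType dsp)
  (P : probability T R) (A : T -> 'M[R]_(d, n)) (z : T -> 'cV[R]_d)
  (tau t gamma : R) :
  compact Q ->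
  distortion Q enc dec = delta ->
  0 < sigma ->
  (forall i j, measurable_fun setT (fun w => A w i j)) ->
  (forall i, measurable_fun setT (fun w => z w i 0)) ->
  (forall i j (B : set R), measurable B ->
      P ((fun w => A w i j) @^-1` B) = normal_prob 0 1 B) ->
  (forall i (B : set R), measurable B ->
      P ((fun w => z w i 0) @^-1` B) = normal_prob 0 sigma B) ->
  mutually_independent P
    (fun (k : ('I_d * 'I_n) + 'I_d) (w : T) =>
       match k with inl ij => A w ij.1 ij.2 | inr i => z w i 0 end) ->
  0 < tau < 1 -> 0 < t -> 0 < gamma ->
  exists E : set T, measurable E /\
    [set w | exists xo chat, Q xo /\
        argmin_code (codebook Q enc dec) (A w) (A w *m xo + z w) chat /\
        norm2 (xo - chat) >=
          (2 * (Num.sqrt n%:R + (t + 1) * Num.sqrt d%:R) * delta + 2 * gamma * sigma)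
            / Num.sqrt ((1 - tau) * d%:R) + delta] `<=` E /\
    (P E <= (expR (- (d%:R * t ^+ 2) / 2)
             + (2 ^ (2 * r))%:R * (expR (- (gamma ^+ 2) / 2)
                 + expR (d%:R / 2 * (tau + ln (1 - tau)))))%:E)%E.
Proof.
move=> cQ dQ sigma0 mA mz lA lz indep tau01 t0 gamma0.
have /andP[tau0 tau1] := tau01.
(* For [d = 0] the denominator in the threshold is zero, but the first exponential equals [1], so
   the whole space will do. *)
have [d0|d0] := posnP d.
  exists setT; split=> //; split=> //.
  rewrite probability_setT lee_fin d0 mul0r oppr0 mul0r expR0 lerDl.
  by rewrite mulr_ge0// addr_ge0// expR_ge0.
pose X (k : ('I_d * 'I_n) + 'I_d) (w : T) : R :=
  match k with inl ij => A w ij.1 ij.2 | inr i => z w i 0 end.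
have mX k : measurable_fun setT (X k) by case: k => [ij|i] /=; [exact: mA|exact: mz].
have gA : gaussian_matrix P A.
  split=> [[i j]||[i j]]; [exact: mA| |exact: lA].
  have inl_inj : injective (@inl ('I_d * 'I_n) 'I_d) by move=> a b [].
  exact: (mutually_independent_sub inl_inj indep).
pose N := (2 ^ r)%N.
pose K := Num.sqrt n%:R + (t + 1) * Num.sqrt d%:R : R.
pose D := Num.sqrt ((1 - tau) * d%:R).
pose q := expR (d%:R / 2 * (tau + ln (1 - tau))).
pose diff (p : 'I_N * 'I_N) := dec p.1 - dec p.2.
have dR0 : 0 < d%:R :> R by rewrite ltr0n.
have K0 : 0 < K by rewrite ltr_wpDl ?sqrtr_ge0// mulr_gt0 ?addr_gt0// sqrtr_gt0.
have D2 : D ^+ 2 = (1 - tau) * d%:R by rewrite sqr_sqrtr// mulr_ge0 ?subr_ge0 ?ltW.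
have D0 : 0 < D by rewrite sqrtr_gt0 mulr_gt0// subr_gt0.
have gs0 : 0 < gamma * sigma by rewrite mulr_gt0.
(* The excess is the cross term [2 * (t + 1) * sqrt n * sqrt d] plus [t * (t + 2) * d]. *)
have ndK : (n + d)%:R <= K ^+ 2.
  have hn : Num.sqrt n%:R ^+ 2 = n%:R :> R by rewrite sqr_sqrtr.
  have hd : Num.sqrt d%:R ^+ 2 = d%:R :> R by rewrite sqr_sqrtr.
  rewrite natrD -hn -hd /K.
  have := sqrtr_ge0 (n%:R : R); have := sqrtr_ge0 (d%:R : R).
  move: (Num.sqrt n%:R) (Num.sqrt d%:R) => b a a0 b0.
  rewrite -subr_ge0.
  have -> : (b + (t + 1) * a) ^+ 2 - (b ^+ 2 + a ^+ 2) =
    2 * (t + 1) * (b * a) + t * (t + 2) * a ^+ 2 by ring.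
  by rewrite addr_ge0// ?mulr_ge0 ?sqr_ge0 ?addr_ge0// ltW.
(* [Q1] takes each unordered pair once, whereas the one-sided noise events need both orders, as in
   [Q2]. *)
pose Q1 : pred ('I_N * 'I_N) := fun p => (p.1 < p.2)%N && (sqnorm (diff p) != 0).
pose Q2 : pred ('I_N * 'I_N) := fun p => sqnorm (diff p) != 0.
pose F1 p := small_event A tau (diff p) `|` gram_event A tau (K ^+ 2) (diff p).
pose F2 p := noise_event A z (gamma * sigma) (diff p).
have mF1 p : measurable (F1 p).
  apply: measurableU; first exact: (measurable_small_event _ gA).
  exact: (measurable_gram_event _ gA).
have mF2 p : measurable (F2 p) by exact: (measurable_noise_event _ _ gA mz).
have mU1 : measurable (\big[setU/set0]_(p | Q1 p) F1 p).
  by apply: bigsetU_measurable => p _.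
have mU2 : measurable (\big[setU/set0]_(p | Q2 p) F2 p).
  by apply: bigsetU_measurable => p _.
exists ((\big[setU/set0]_(p | Q1 p) F1 p) `|` (\big[setU/set0]_(p | Q2 p) F2 p)).
split; first exact: measurableU.
split.
  move=> w [xo [chat [Qxo [[[x' Qx' <-] opt] err]]]].
  have xoc : norm2 (xo - dec (enc xo)) <= delta.
    by rewrite -dQ; exact: le_distortion.
  have := opt (dec (enc xo)) (ex_intro2 _ _ xo Qxo erefl).
  rewrite !sqr_norm2 => opt'.
  rewrite -[2 * gamma * sigma]mulrA in err.
  have [v0] := decoding_error_cases K0 gs0 D0 xoc opt' err.
  pose a := enc xo; pose b := enc x'.
  rewrite D2 => cases.
  have inU2 : F2 (a, b) w -> (\big[setU/set0]_(p | Q2 p) F2 p) w.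
    by move=> Fw; rewrite (bigD1 (a, b))//=; left.
  have inU1 : F1 (a, b) w -> (\big[setU/set0]_(p | Q1 p) F1 p) w.
    move=> Fw; have [ab|ba|ab] := ltngtP a b.
    - by rewrite (bigD1 (a, b)) /Q1/= ?ab//; left.
    - have dN : diff (b, a) = - diff (a, b) by rewrite /diff/= opprB.
      rewrite (bigD1 (b, a)) /Q1/=; first by left; rewrite /F1 dN small_eventN gram_eventN.
      by rewrite ba dN sqnormN.
    - have abE : a = b by exact: val_inj.
      move: v0; rewrite -/a -/b abE subrr.
      by rewrite /sqnorm big1 ?eqxx// => i _; rewrite mxE expr0n.
  by case: cases => h; [left; apply: inU1; left|left; apply: inU1; right|right; exact: inU2].
have P1 p : Q1 p -> (P (F1 p) <= (q + q)%:E)%E.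
  move=> /andP[_ v0]; apply: le_trans (measureU2 _ _ _) _.
  - exact: (measurable_small_event _ gA).
  - exact: (measurable_gram_event _ gA).
  by rewrite EFinD leeD//; [exact: tail_small|exact: tail_gram].
have P2 p : Q2 p -> (P (F2 p) <= (expR (- gamma ^+ 2 / 2))%:E)%E.
  by move=> _; exact: (tail_noise sigma0 mX indep lz).
apply: le_trans (measureU2 _ mU1 mU2) _.
apply: le_trans (leeD (measure_bigsetU_le_card (fun p _ => mF1 p) P1)
                      (measure_bigsetU_le_card (fun p _ => mF2 p) P2)) _.
rewrite -EFinD lee_fin.
have NN : (2 ^ (2 * r))%:R = (N * N)%:R :> R by rewrite /N -expnD mul2n addnn.
have c2 : #|Q2|%:R <= (N * N)%:R :> R.
  by rewrite ler_nat (leq_trans (max_card _))// card_prod card_ord.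
(* Each pair of [Q1] costs [q + q], so twice their number is what has to fit below [N * N]. *)
have c1 : #|Q1|%:R *+ 2 <= (N * N)%:R :> R.
  rewrite -mulrnA muln2 ler_nat (leq_trans _ (card_ltn_pairs N))//.
  by rewrite leq_double; apply/subset_leq_card/fintype.subsetP => p /andP[].
have q0 : 0 <= q by exact: expR_ge0.
have e0 := expR_ge0 (- gamma ^+ 2 / 2).
have h1 := ler_wpM2r q0 c1; have h2 := ler_wpM2r e0 c2.
have e1 := expR_ge0 (- (d%:R * t ^+ 2) / 2).
rewrite NN -/q mulrDr; rewrite mulr2n in h1; lra.
Qed.
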